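(* Fix an integer $\kappa\ge0$, and for $r\ge2$ set $s=2r+\kappa$. Let $\tau_{r,\kappa,1}<\cdots<\tau_{r,\kappa,r-1}<0$ be the zeros of the polynomial $\mathbb{H}_{T_{r,2r+\kappa},\rho}(1,t)$ in $t$, where $T_{r,s}$ is the trapezoidal poset with rank $\rho(i,c)=c-i$. Then for every continuous compactly supported function $f$ on $(-\infty,0)$, $$\lim_{r\to\infty}\frac1{r-1}\sum_{j=1}^{r-1}f(\tau_{r,\kappa,j})=\frac1\pi\int_{-\infty}^{0}\frac{f(t)}{\sqrt{-t}\,(1-t)}\,dt.$$ The limit is independent of $\kappa$. Equivalently, if $j_r/(r-1)\to u\in(0,1)$ as $r\to\infty$ (with $1\le j_r\le r-1$ integers), then $$\tau_{r,\kappa,j_r}\longrightarrow-\cot^2\!\left(\frac{\pi u}{2}\right).$$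
   Context: $q$-Zeta numerator: let $P$ be a finite graded poset with a unique maximum and rank function $\rho:P\to\{0,\dots,H\}$, where $H$ is the maximal rank. For $m\ge 0$ put $A_m(P,\rho;q)=\sum_{x_1\le\cdots\le x_m}q^{\rho(x_1)+\cdots+\rho(x_m)}$ (sum over weak chains in $P$; $A_0=1$). The numerator $\mathbb{H}_{P,\rho}(q,t)$ is the polynomial determined by $\sum_{m\ge 0}A_m(P,\rho;q)t^m=\mathbb{H}_{P,\rho}(q,t)/\prod_{a=0}^{H}(1-q^at)$. Trapezoidal poset (for $s\ge2r\ge2$): $T_{r,s}=\{(i,c):1\le i\le r,\ i\le c\le s-i\}$, ordered by $(i,c)\le(j,d)\iff i\ge j$ and $c\le d$. It is known that $\mathbb{H}_{T_{r,s},\rho}(1,t)=\sum_{k=0}^{r-1}\binom{r-1}{k}\binom{s-r-1}{k}t^k$, which has $r-1$ simple negative zeros. *)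

(* Defs.v *)
From HB Require Import structures.
From mathcomp Require Import all_boot all_order all_algebra.
From mathcomp Require Import all_classical all_reals all_analysis.

Set Implicit Arguments.
Unset Strict Implicit.
Unset Printing Implicit Defensive.

Import Order.TTheory GRing.Theory Num.Theory.
Import numFieldNormedType.Exports.

Local Open Scope classical_set_scope.
Local Open Scope ring_scope.

Section QZeta.
Context {d : Order.disp_t} {P : finPOrderType d} (rho : P -> nat).

Definition max_rank : nat := (\max_(x : P) rho x)%N.

(* A weak chain x_1 <= ... <= x_m is a sorted m-tuple; the indeterminate of
   {poly int} is q. *)
Definition qzeta_sum (m : nat) : {poly int} :=
  \sum_(x : m.-tuple P | sorted <=%O x) 'X^(\sum_(i < m) rho (tnth x i)).

(* Elements of {poly {poly int}} are polynomials in t over Z[q]. *)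
Definition qzeta_denominator : {poly {poly int}} :=
  \prod_(a < max_rank.+1) (1 - ('X^a)%:P * 'X).

(* The identity  sum_m A_m t^m = N / prod_a (1 - q^a t)  of formal power series
   in t, multiplied by the denominator (invertible as its constant term is 1)
   and read off coefficientwise. *)
Definition is_qzeta_numerator (N : {poly {poly int}}) : Prop :=
  forall n : nat,
    \sum_(k < n.+1) qzeta_sum (n - k) * qzeta_denominator`_k = N`_n.

Lemma is_qzeta_numerator_inj (N1 N2 : {poly {poly int}}) :
  is_qzeta_numerator N1 -> is_qzeta_numerator N2 -> N1 = N2.
Proof. by move=> h1 h2; apply/polyP => n; rewrite -h1 -h2. Qed.

Definition qzeta_numerator : {poly {poly int}} :=
  xget 0 [set N | is_qzeta_numerator N].

(* The numerator at q = 1, as a polynomial in t with coefficients in R. *)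
Definition qzeta_numerator_at1 (R : realType) : {poly R} :=
  map_poly (fun c : {poly int} => (c.[1])%:~R) qzeta_numerator.

End QZeta.

Section Trapezoid.
Variables r s : nat.

Definition in_trapezoid : pred ('I_r.+1 * 'I_s.+1) :=
  fun x => [&& 1 <= x.1, x.1 <= x.2 & x.2 <= s - x.1]%N.

Definition trapezoid : Type := {x | in_trapezoid x}.

HB.instance Definition _ := Finite.on trapezoid.

Definition trapezoid_row (x : trapezoid) : nat := (val x).1.
Definition trapezoid_col (x : trapezoid) : nat := (val x).2.

Definition trapezoid_le : rel trapezoid := fun x y =>
  (trapezoid_row y <= trapezoid_row x)%N &&
  (trapezoid_col x <= trapezoid_col y)%N.

Lemma trapezoid_le_refl : reflexive trapezoid_le.
Proof. by move=> x; rewrite /trapezoid_le !leqnn. Qed.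

Lemma trapezoid_le_anti : antisymmetric trapezoid_le.
Proof.
move=> x y /andP[/andP[yx1 xy2] /andP[xy1 yx2]].
apply/val_inj/eqP; rewrite /eq_op /= -!val_eqE /= !eqn_leq.
by apply/andP; split; apply/andP.
Qed.

Lemma trapezoid_le_trans : transitive trapezoid_le.
Proof.
move=> y x z /andP[yx1 xy2] /andP[zy1 yz2].
by rewrite /trapezoid_le (leq_trans zy1 yx1) (leq_trans xy2 yz2).
Qed.

Fact trapezoid_display : Order.disp_t. Proof. exact: Order.Disp. Qed.

HB.instance Definition _ := Order.Le_isPOrder.Build trapezoid_display trapezoid
  trapezoid_le_refl trapezoid_le_anti trapezoid_le_trans.

(* The subtraction is exact, since i <= c on the trapezoid. *)
Definition trapezoid_rank (x : trapezoid) : nat :=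
  (trapezoid_col x - trapezoid_row x)%N.

End Trapezoid.

(* tau 1 < ... < tau n < 0 is the list of all zeros of p; the values of tau
   outside [1, n] are irrelevant. *)
Definition increasing_negative_zeros (R : realType) (p : {poly R}) (n : nat)
    (tau : nat -> R) : Prop :=
  [/\ forall i j : nat, (1 <= i)%N -> (i < j)%N -> (j <= n)%N -> tau i < tau j,
      forall j : nat, (1 <= j <= n)%N -> tau j < 0
    & forall x : R, root p x <-> exists2 j : nat, (1 <= j <= n)%N & x = tau j].

(* f restricted to the open set U is continuous and its support, the closure
   relative to U of the nonvanishing locus, is compact; nothing is required of
   f outside U. *)
Definition continuous_compactly_supported_on (R : realType) (U : set R)
    (f : R -> R) : Prop :=
  {within U, continuous f} /\
  compact (U `&` closure [set t | U t /\ f t != 0]).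

Definition cot (R : realType) (x : R) : R := cos x / sin x.

(* Main.v *)
Require Import Defs.
From HB Require Import structures.
From mathcomp Require Import all_boot all_order all_algebra.
From mathcomp Require Import all_classical all_reals all_analysis.
From mathcomp Require Import ring lra zify.

Set Implicit Arguments.
Unset Strict Implicit.
Unset Printing Implicit Defensive.

Import Order.TTheory GRing.Theory Num.Theory.
Import numFieldNormedType.Exports.
Local Open Scope classical_set_scope.
Local Open Scope ring_scope.

(** By Lindstrom-Gessel-Viennot, the weak chains of length m of the trapezoid
    number C(m + r - 1, m) C(m + s - r - 1, m), so that at q = 1 the numerator
    is p(t) = sum_k C(n, k) C(n + kappa, k) t^k with n = r - 1.  By
    Cauchy-Schwarz, p(y^2) equals (1 + y)^(2n) up to a factor polynomial in n,
    and so does the even part ((1 + y)^(2n) + (1 - y)^(2n)) / 2, whose zeros in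
    t = y^2 are - tan^2 ((2j - 1) pi / (4n)).  Comparing logarithms, the points
    1 / (1 - tau_j) and the corresponding points cos^2 ((2j - 1) pi / (4n)) have
    the same asymptotic averages of ln (1 + z w), hence the same asymptotic
    moments, hence, through polynomials close to step functions, the same
    asymptotic quantiles.  The weak limit follows from the convergence of the
    quantiles by dominated convergence on (0, 1) and a change of variables. *)

(** The limit density decays only like [|t|^(-3/2)], so the limit law of the zeros has no mean and
    moments cannot be taken in [t] itself. The map [t -> 1 / (1 - t)] moves the zeros into [(0, 1)],
    and it comes for free: in [p(1 + z) / p(1)] the leading coefficient cancels and the zero [tau_j]
    contributes the factor [1 + z / (1 - tau_j)]. In this variable the limit is the arcsine law. The
    limit law is never computed from [p]: the even part has explicit zeros, and a factor polynomial
    in [n] costs [O(ln n)] in the logarithm, which disappears after division by [n]. Since [kappa]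
    enters only through such a factor, the limit does not depend on it. The points [1 / (1 - tau_j)]
    increase with [j], so knowing which fraction of them exceeds each threshold already locates the
    point of a given index. With quantiles known first, the weak limit reduces to a pointwise limit
    of step functions. *)

Lemma big_tuple_cons (V : nmodType) (T : finType) (n : nat)
    (F : n.+1.-tuple T -> V) :
  \sum_(t : n.+1.-tuple T) F t =
  \sum_(x : T) \sum_(t : n.-tuple T) F [tuple of x :: t].
Proof.
rewrite pair_bigA /=.
rewrite (reindex (fun p : T * n.-tuple T => [tuple of p.1 :: p.2])) //.
exists (fun t : n.+1.-tuple T => (thead t, [tuple of behead t])).
- by move=> [x t] _; congr (_, _); apply: val_inj.
- by move=> t _; rewrite [t in RHS]tuple_eta.
Qed.

(** * Weak chains of the trapezoid *)

Section WeakChains.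
Context {d : Order.disp_t} {P : finPOrderType d}.

Definition chains_above (m : nat) (x : P) : nat :=
  \sum_(t : m.-tuple P | path <=%O x t) 1.

Definition weak_chains (m : nat) : nat :=
  \sum_(t : m.-tuple P | sorted <=%O t) 1.

Lemma chains_above0 x : chains_above 0 x = 1%N.
Proof.
rewrite /chains_above (big_pred1 [tuple]) // => t.
by rewrite tuple0 /= eqxx.
Qed.

Lemma chains_aboveS m x :
  chains_above m.+1 x = (\sum_(y | (x <= y)%O) chains_above m y)%N.
Proof.
rewrite /chains_above big_mkcond big_tuple_cons [RHS]big_mkcond.
apply: eq_bigr => y _; case: ifP => xy.
- rewrite [RHS]big_mkcond; apply: eq_bigr => t _ /=.
  by rewrite xy.
- by rewrite big1 // => t _ /=; rewrite xy.
Qed.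

Lemma weak_chains0 : weak_chains 0 = 1%N.
Proof.
rewrite /weak_chains (big_pred1 [tuple]) // => t.
by rewrite tuple0 /= eqxx.
Qed.

Lemma weak_chainsS m : weak_chains m.+1 = (\sum_x chains_above m x)%N.
Proof.
rewrite /weak_chains /chains_above big_mkcond big_tuple_cons.
by apply: eq_bigr => y _; rewrite [RHS]big_mkcond; apply: eq_bigr.
Qed.

End WeakChains.

(* The Lindstrom-Gessel-Viennot determinant counting the weak chains of length
   [n] above the element [(x + 1, s - 1 - y)] of the trapezoid. *)
Definition chain_det (n x y : nat) : int :=
  'C(x + n, n)%:Z * 'C(y + n, n)%:Z - 'C(x + n, n.+1)%:Z * 'C(y + n, y.+1)%:Z.

Lemma bin_addC m n : 'C(m + n, m) = 'C(m + n, n).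
Proof. by rewrite -bin_sub ?leq_addr// addKn. Qed.

(** The right side is a 2 by 2 determinant that vanishes at [y = x], and by Pascal's rule its
    increment in [y] is [chain_det n x y]. *)
Lemma sum_chain_det_row n x y : (x <= y)%N ->
  \sum_(x <= y' < y) chain_det n x y' =
  'C(x + n, n)%:Z * 'C(y + n, n.+1)%:Z - 'C(x + n, n.+1)%:Z * 'C(y + n, n)%:Z.
Proof.
elim: y => [|y IH].
  by rewrite leqn0 => /eqP ->; rewrite big_geq// mulrC subrr.
rewrite leq_eqVlt => /orP[/eqP <-|]; first by rewrite big_geq// mulrC subrr.
rewrite ltnS => xy; rewrite big_nat_recr//= IH// /chain_det !addSn !binS.
(* ['C(y + n, y.+1)] is the binomial coefficient of [y + n] over [n - 1], in a form that is
   correctly 0 at [n = 0]. *)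
have -> : 'C((y + n).+1, n) = ('C(y + n, n) + 'C(y + n, y.+1))%N.
  by rewrite -addSn -bin_addC addSn binS addnC bin_addC.
by rewrite !PoszD; ring.
Qed.

Lemma sum_chain_det n x y : (x <= y)%N ->
  \sum_(0 <= x' < x) \sum_(x' <= y' < y) chain_det n x' y' =
  'C(x + n, n.+1)%:Z * 'C(y + n, n.+1)%:Z - 'C(x + n, n.+2)%:Z * 'C(y + n, n)%:Z.
Proof.
elim: x => [|x IH] xy.
  by rewrite big_geq// add0n (@bin_small n n.+1)// (@bin_small n n.+2)//; ring.
rewrite big_nat_recr//= IH 1?ltnW// sum_chain_det_row 1?ltnW//.
by rewrite !addSn !binS !PoszD; ring.
Qed.

(** In the coordinates [x = i - 1], [y = s - 1 - c] the elements above [(x, y)] are the pairs with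
    [x' <= x] and [x' <= y' <= y]; the other bound [y' < s - 1 - x'] is inherited from [(x, y)].
    This is therefore the recursion satisfied by the chain counts. *)
Lemma sum_chain_detS n x y : (x <= y)%N ->
  \sum_(0 <= x' < x.+1) \sum_(x' <= y' < y.+1) chain_det n x' y' =
  chain_det n.+1 x y.
Proof.
move=> xy; rewrite sum_chain_det// /chain_det !addnS !addSn.
by rewrite -[in 'C(_, y.+1)]addSn bin_addC addSn.
Qed.

(** Passing from [r] to [r + 1] lowers [s - r] by one; Pascal's rule in both factors leaves exactly
    the sum of row [r], so the determinants collapse to a single product. *)
Lemma total_chain_det n r s : (r + r <= s)%N ->
  \sum_(0 <= x < r) \sum_(x <= y < s.-1 - x) chain_det n x y =
  ('C(r + n, n.+1) * 'C(s - r + n, n.+1))%N%:Z.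
Proof.
elim: r => [|r IH] rs; first by rewrite big_geq// add0n bin_small.
rewrite big_nat_recr//= IH; last lia.
rewrite sum_chain_det_row; last lia.
have -> : (s - r = (s.-1 - r).+1)%N by lia.
have -> : (s - r.+1 = s.-1 - r)%N by lia.
by rewrite !addSn !binS !PoszM !PoszD; ring.
Qed.

Section TrapezoidChains.
Variables r s : nat.
Local Notation T := (trapezoid r s).
Local Notation row := (@trapezoid_row r s).
Local Notation col := (@trapezoid_col r s).

Lemma trapezoidP (x : T) : [&& 1 <= row x, row x <= col x, col x <= s - row x &
  row x <= r]%N.
Proof.
have /and3P[h1 h2 h3] := valP x; apply/and4P; split => //.
by rewrite -ltnS; exact: ltn_ord.
Qed.

Lemma sum_trapezoid (F : nat -> nat -> int) :
  \sum_(x : T) F (row x) (col x) =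
  \sum_(0 <= x < r) \sum_(x <= y < s.-1 - x) F x.+1 (s.-1 - y)%N.
Proof.
rewrite -(big_sub (in_trapezoid (r := r) (s := s))
  (fun p => F p.1 p.2)).
have inT (i : 'I_r.+1) (j : 'I_s.+1) :
  ((i, j) \in @in_trapezoid r s) = [&& 1 <= i, i <= j & j <= s - i]%N by [].
rewrite big_mkcond /=.
rewrite -(pair_bigA _ (fun (i : 'I_r.+1) (j : 'I_s.+1) =>
  if (i, j) \in in_trapezoid (r:=r) (s:=s) then F i j else 0)) /=.
rewrite big_ord_recl big1 // add0r.
rewrite big_mkord; apply: eq_bigr => i _.
have [si|si] := leqP (s.-1 - i) i.
  rewrite [RHS]big_geq// big1// => j _; case: ifP => //.
  by rewrite inT lift0; lia.
rewrite big_nat_rev/= [RHS](_ : _ = \sum_(i.+1 <= c < s - i) F i.+1 c); last first.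
  rewrite (_ : s - i = (s.-1 - i).+1)%N; last lia.
  rewrite big_add1 /=; apply: eq_big_nat => c hc.
  by congr (F _ _); lia.
rewrite (big_nat_widen _ _ s.+1); last lia.
rewrite (big_nat_widenl _ 0)// big_mkcond big_mkord.
apply: eq_bigr => j _.
have -> : (lift ord0 i, j) \in in_trapezoid (r:=r) (s:=s) = (i < j < s - i)%N.
  by rewrite inT lift0; lia.
by rewrite andbC.
Qed.

Hypothesis r2s : (r + r <= s)%N.

Lemma chains_above_trapezoid m (x : T) :
  (chains_above m x)%:Z = chain_det m (row x).-1 (s.-1 - col x).
Proof.
elim: m x => [|m IH] x.
  (* At length 0 the subtracted product contains ['C(y, y.+1) = 0]. *)
  by rewrite chains_above0 /chain_det !addn0 !bin0 (bin_small (ltnSn _)); ring.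
rewrite chains_aboveS raddf_sum /= big_mkcond /=.
rewrite (eq_bigr (fun y : T => if (row y <= row x)%N && (col x <= col y)%N then
   chain_det m (row y).-1 (s.-1 - col y) else 0)); last first.
  by move=> y _; rewrite IH.
rewrite (sum_trapezoid (fun i c => if (i <= row x)%N && (col x <= c)%N then
   chain_det m i.-1 (s.-1 - c) else 0)).
have /and4P[h1 h2 h3 h4] := trapezoidP x.
rewrite -sum_chain_detS; last lia.
rewrite [RHS](big_nat_widen _ _ r); last lia.
rewrite [RHS]big_mkcond; apply: eq_big_nat => i hi /=.
case: ifP => hir; last first.
  by rewrite big_nat big1// => j hj; rewrite (_ : (i < row x)%N = false)//; lia.
rewrite [RHS](big_nat_widen _ _ (s.-1 - i)); last lia.
rewrite [RHS]big_mkcond; apply: eq_big_nat => j hj /=.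
rewrite (_ : (s.-1 - (s.-1 - j))%N = j); last lia.
by congr (if _ then _ else _); lia.
Qed.

Lemma weak_chains_trapezoid m : (0 < r)%N ->
  @weak_chains _ T m = ('C(m + r.-1, r.-1) * 'C(m + (s - r).-1, (s - r).-1))%N.
Proof.
move=> r0; case: m => [|m]; first by rewrite weak_chains0 !binn.
apply/eqP; rewrite -eqz_nat weak_chainsS raddf_sum /=.
rewrite (eq_bigr _ (fun x _ => chains_above_trapezoid m x)).
rewrite (sum_trapezoid (fun i c => chain_det m i.-1 (s.-1 - c))).
rewrite -[X in Posz (X * _)]bin_addC -[X in Posz (_ * X)]bin_addC.
have -> : (m.+1 + r.-1 = r + m)%N by lia.
have -> : (m.+1 + (s - r).-1 = s - r + m)%N by lia.
rewrite -total_chain_det//.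
apply/eqP/eq_big_nat => i hi; apply: eq_big_nat => j hj /=.
by congr chain_det; lia.
Qed.

(** The maximum is reached at [(1, s - 1)]. At [q = 1] the denominator becomes [(1 - t)^(s - 1)],
    and [s - 1 = (r - 1) + (s - r - 1) + 1] is the order of the pole at 1 of the chain series. *)
Lemma max_rank_trapezoid : (0 < r)%N -> max_rank (@trapezoid_rank r s) = (s - 2)%N.
Proof.
move=> r0; apply/eqP; rewrite eqn_leq; apply/andP; split.
  apply/bigmax_leqP => x _; have /and4P[h1 h2 h3 h4] := trapezoidP x.
  by rewrite /trapezoid_rank; lia.
have h1 : (1 < r.+1)%N by lia.
have h2 : (s.-1 < s.+1)%N by lia.
have h : in_trapezoid (Ordinal h1, Ordinal h2) by rewrite /in_trapezoid /=; lia.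
rewrite (leq_trans _ (leq_bigmax (exist (fun p => is_true (in_trapezoid p)) _ h : T)))//.
by rewrite /trapezoid_rank /trapezoid_col /trapezoid_row /=; lia.
Qed.

End TrapezoidChains.

(** * The numerator at q = 1 *)

Section SegreNumerator.
Variable R : numFieldType.

(** The Hilbert series of the Segre product of polynomial rings in [a + 1] and [b + 1] variables,
    cut off below degree [M] so as to stay among polynomials. *)
Definition segre_poly (M a b : nat) : {poly R} :=
  \poly_(i < M) ('C(i + a, a) * 'C(i + b, b))%:R.

Lemma bin_left_natr (a k : nat) :
  (a%:R - k%:R) * 'C(a, k)%:R = k.+1%:R * 'C(a, k.+1)%:R :> R.
Proof.
have [ka|ak] := leqP k a; first by rewrite -natrB// -!natrM mul_bin_left.
by rewrite !bin_small ?mulr0//; lia.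
Qed.

Lemma coef_oneBX_exp_segreS (M a b : nat) :
  (forall m, (m < M)%N -> ((1 - 'X) ^+ (a + b).+1 * segre_poly M a b)`_m =
     ('C(a, m) * 'C(b, m))%:R) ->
  forall m, (m < M)%N -> ((1 - 'X) ^+ (a + b.+1).+1 * segre_poly M a b.+1)`_m =
     ('C(a, m) * 'C(b.+1, m))%:R.
Proof.
move=> IH m mM; set z := segre_poly M a b in IH *.
pose y := (1 - 'X) ^+ (a + b).+1 * z.
have bz : b.+1%:R *: segre_poly M a b.+1 = 'X * z^`() + b.+1%:R *: z.
  apply/polyP => i; rewrite coefZ coefD coefXM coefZ coef_deriv !coef_poly.
  case: i => [|i] /=; first by case: ifP; rewrite ?add0n ?binn ?add0r.
  case: ifP => _; last by rewrite !mulr0 mul0rn add0r.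
  rewrite -[_ *+ i.+1]mulr_natl -mulrDl -natrD -!natrM; congr (_%:R).
  have := mul_bin_diag (i.+1 + b.+1) b; rewrite !addnS /= => e.
  by rewrite !mulnA ![(_ * 'C(_.+1 + a, _))%N]mulnC -!mulnA; congr muln; lia.
(* In terms of the numerator [y] for [b], the next one is [t (1 - t) y' + (a + b + 1) t y + (b + 1)
   (1 - t) y], up to the factor [b + 1]. Its coefficient [m] uses only coefficients [m - 1] and [m]
   of [y], so the truncation does no harm. *)
have ey : (1 - 'X) ^+ (a + b.+1).+1 * (b.+1%:R *: segre_poly M a b.+1) =
    'X * y^`() - 'X * ('X * y^`()) + (a + b).+1%:R *: ('X * y) +
    b.+1%:R *: (y - 'X * y).
  rewrite bz /y derivM deriv_exp derivB derivX derivC sub0r /=.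
  rewrite addnS [_ ^+ (a + b).+2]exprS [_ ^+ (a + b).+1]exprS -!mul_polyC.
  rewrite !polyC_natr -[_ *+ (a + b).+1]mulr_natr.
  by ring.
have := congr1 (fun p : {poly R} => p`_m) ey => /=.
rewrite -scalerAr coefZ.
have b0 : b.+1%:R != 0 :> R by rewrite pnatr_eq0.
move=> e; apply: (mulfI b0); rewrite e {e ey bz}.
rewrite !(coefD, coefN, coefZ, coefXM, coef_deriv).
case: m mM => [|[|k]] mM /=.
- by rewrite IH// !bin0; ring.
- rewrite !IH ?(ltnW mM)// !bin0 !bin1 !mulr1n.
  by rewrite !natrM; ring.
- rewrite !IH ?(ltnW mM)//.
  have ha := bin_left_natr a k.+1; have hb := bin_left_natr b k.+1.
  rewrite !natrM [in RHS]binS natrD.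
  rewrite -![(_ * _) *+ _]mulr_natl.
  rewrite -!natr1 natrD in ha hb *.
  set A := 'C(a, k.+2)%:R in ha *; set A0 := 'C(a, k.+1)%:R in ha *.
  set B := 'C(b, k.+2)%:R in hb *; set B0 := 'C(b, k.+1)%:R in hb *.
  have ha' : a%:R * A0 = (k%:R + 1) * A0 + (k%:R + 1 + 1) * A by rewrite -ha; ring.
  have hb' : b%:R * B0 = (k%:R + 1) * B0 + (k%:R + 1 + 1) * B by rewrite -hb; ring.
  by ring: ha' hb'.
Qed.

(* Differentiating in [t] raises [b] by one: [(b + 1) S(a, b + 1) =
   (t d/dt + b + 1) S(a, b)] for the series [S(a, b)] truncated here. *)
Lemma coef_oneBX_exp_segre (M a b m : nat) : (m < M)%N ->
  ((1 - 'X) ^+ (a + b).+1 * segre_poly M a b)`_m = ('C(a, m) * 'C(b, m))%:R.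
Proof.
have segreC c e : segre_poly M c e = segre_poly M e c.
  by apply/polyP => i; rewrite !coef_poly mulnC.
have h00 n : (n < M)%N ->
    ((1 - 'X) ^+ (0 + 0).+1 * segre_poly M 0 0)`_n = ('C(0, n) * 'C(0, n))%:R.
  move=> nM; rewrite addn0 expr1 mulrBl mul1r coefB coefXM !coef_poly.
  case: n nM => [|n] nM /=; first by rewrite nM !bin0 subr0.
  by rewrite nM (ltnW nM) !bin0 subrr.
(* Only [b] can be raised: [(a, b)] is reached from [(0, 0)] through [(0, a)], the symmetric pair
   [(a, 0)], and then [b] steps. *)
have ha0 c n : (n < M)%N ->
    ((1 - 'X) ^+ (0 + c).+1 * segre_poly M 0 c)`_n = ('C(0, n) * 'C(c, n))%:R.
  by elim: c n => [|c IH]; [exact: h00 | exact: coef_oneBX_exp_segreS].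
elim: b m => [|b IH]; last exact: coef_oneBX_exp_segreS.
by move=> m mM; rewrite addnC segreC ha0// mulnC.
Qed.

End SegreNumerator.

Section Numerator.
Variables (R : realType) (r s : nat).
Hypotheses (r0 : (0 < r)%N) (r2s : (r + r <= s)%N).
Local Notation rho := (@trapezoid_rank r s).

(** [qzeta_numerator] takes the default value 0 when no numerator exists, and every point is a root
    of 0. A single point that is not a root thus certifies that a genuine numerator was chosen. *)
Lemma is_qzeta_numerator_xget (x : R) :
  ~~ root (qzeta_numerator_at1 rho R) x ->
  is_qzeta_numerator rho (qzeta_numerator rho).
Proof.
move=> rx; rewrite /qzeta_numerator; case: xgetP => [N -> //|nN].
move/negP: rx; rewrite /qzeta_numerator_at1 /qzeta_numerator.
by case: xgetP => [N _ /nN //|_]; rewrite map_poly0 root0.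
Qed.

Lemma qzeta_numerator_at1_trapezoid (x : R) :
  ~~ root (qzeta_numerator_at1 rho R) x ->
  qzeta_numerator_at1 rho R =
  \poly_(k < r) ('C(r.-1, k) * 'C((s - r).-1, k))%:R.
Proof.
move=> /is_qzeta_numerator_xget hN.
have [ev evE] : exists ev : {rmorphism {poly int} -> R},
    forall c, ev c = (c.[1])%:~R by exists (intr \o horner_eval 1).
rewrite /qzeta_numerator_at1 -(eq_map_poly evE).
apply/polyP => n; rewrite coef_map -[LHS]/(ev _) -hN rmorph_sum.
under eq_bigr do rewrite rmorphM.
(* The truncated series is correct up to degree [n], and the convolution for coefficient [n] asks
   for no more. *)
have evA m : ev (qzeta_sum rho m) = (segre_poly R n.+1 r.-1 (s - r).-1)`_m
    :> R \/ (n < m)%N.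
  have [mn|nm] := leqP m n; [left|by right].
  rewrite coef_poly ltnS mn -weak_chains_trapezoid//.
  rewrite /qzeta_sum /weak_chains natr_sum rmorph_sum /=.
  by apply: eq_bigr => t _; rewrite evE hornerXn expr1n.
have evD : map_poly ev (qzeta_denominator rho) = (1 - 'X) ^+ (r.-1 + (s - r).-1).+1.
  rewrite /qzeta_denominator rmorph_prod max_rank_trapezoid//.
  rewrite (_ : (r.-1 + (s - r).-1).+1 = (s - 2).+1); last lia.
  rewrite (eq_bigr (fun=> 1 - 'X)) ?prodr_const ?card_ord// => i _.
  rewrite rmorphB rmorph1 rmorphM /= map_polyX map_polyC /=.
  by rewrite evE hornerXn expr1n mul1r.
rewrite (eq_bigr (fun k : 'I_n.+1 => ((1 - 'X) ^+ (r.-1 + (s - r).-1).+1)`_k *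
  (segre_poly R n.+1 r.-1 (s - r).-1)`_(n - k))); last first.
  move=> k _; rewrite mulrC -evD coef_map.
  by case: (evA (n - k)%N) => [->//|]; rewrite ltnNge leq_subr.
rewrite -coefM coef_oneBX_exp_segre// coef_poly; case: ifP => // /negbT.
by rewrite -leqNgt => rn; rewrite bin_small//; lia.
Qed.

End Numerator.

(** * Comparison with a trigonometric polynomial *)

Section RootProduct.
Variable R : realType.

Lemma ln_prod (T : eqType) (s : seq T) (F : T -> R) :
  {in s, forall i, 0 < F i} ->
  0 < \prod_(i <- s) F i /\ ln (\prod_(i <- s) F i) = \sum_(i <- s) ln (F i).
Proof.
elim: s => [|i s IH] Fs; first by rewrite !big_nil ln1.
have [|p0 pE] := IH; first by move=> j js; apply: Fs; rewrite inE js orbT.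
have Fi : 0 < F i by apply: Fs; rewrite inE eqxx.
by rewrite !big_cons mulr_gt0// lnM ?posrE// pE.
Qed.

(** With [n] distinct roots and degree at most [n], [P] splits into the factors [x - rho j]; the
    quotient of its values at [1 + z] and [1] cancels the leading coefficient. *)
Lemma ln_root_ratio (P : {poly R}) (n : nat) (rho : nat -> R) (z : R) :
  0 <= z -> (size P <= n.+1)%N ->
  {in [pred j | 1 <= j <= n]%N &, injective rho} ->
  (forall j, (1 <= j <= n)%N -> root P (rho j)) ->
  (forall j, (1 <= j <= n)%N -> rho j < 0) ->
  0 < P.[1] -> 0 < P.[1 + z] ->
  ln P.[1 + z] - ln P.[1] =
  \sum_(1 <= j < n.+1) ln (1 + z * (1 - rho j)^-1).
Proof.
move=> z0 sP irho Prho rho0 P1 Pz.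
have P0 : P != 0 by apply/eqP => P0; move: P1; rewrite P0 horner0 ltxx.
pose rs := map rho (index_iota 1 n.+1).
have rsP : all (root P) rs.
  by apply/allP => x /mapP[j]; rewrite mem_index_iota => ? ->; exact: Prho.
have urs : uniq rs.
  rewrite map_inj_in_uniq ?iota_uniq// => i j.
  by rewrite !mem_index_iota => hi hj; exact: irho.
have szrs : size rs = n by rewrite size_map size_iota subn1.
have sizeP : size P = (size rs).+1.
  by apply/eqP; rewrite eqn_leq (max_poly_roots P0 rsP urs) szrs sP.
have PE x : P.[x] = lead_coef P * \prod_(1 <= j < n.+1) (x - rho j).
  rewrite {1}(all_roots_prod_XsubC sizeP rsP) ?uniq_rootsE//.
  rewrite hornerZ horner_prod big_map; congr (_ * _).
  by apply: eq_bigr => j _; rewrite hornerXsubC.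
have F1 : {in index_iota 1 n.+1, forall j, 0 < 1 - rho j}.
  move=> j; rewrite mem_index_iota => hj.
  by rewrite subr_gt0 (lt_trans (rho0 j hj))// ltr01.
have Fz : {in index_iota 1 n.+1, forall j, 0 < 1 + z - rho j}.
  by move=> j /F1; lra.
have [p1 lp1] := ln_prod F1; have [pz lpz] := ln_prod Fz.
have l0 : 0 < lead_coef P by move: P1; rewrite PE pmulr_lgt0.
rewrite !PE !lnM ?posrE// lp1 lpz opprD addrACA subrr add0r -sumrB.
apply: eq_big_nat => j hj.
have hj' : j \in index_iota 1 n.+1 by rewrite mem_index_iota.
rewrite -ln_div ?posrE ?F1 ?Fz//; congr ln.
have := F1 j hj' => h; field; lra.
Qed.

End RootProduct.

Section EvenPart.
Variable R : realType.

(* [(1 + y)^m = A_m(y^2) + y * B_m(y^2)] with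
   [binomial_parts m = (A_m, B_m)]. *)
Fixpoint binomial_parts (m : nat) : {poly R} * {poly R} :=
  if m is m'.+1 then
    let: (A, B) := binomial_parts m' in (A + 'X * B, A + B)
  else (1, 0).

Lemma size_binomial_parts n :
  (size (binomial_parts n.*2).1 <= n.+1)%N /\
  (size (binomial_parts n.*2).2 <= n)%N.
Proof.
elim: n => [|n]; first by rewrite /= size_polyC size_poly0 oner_eq0.
rewrite doubleS /=; case: (binomial_parts n.*2) => A B /= [sA sB].
have sX (p : {poly R}) k : (size p <= k -> size ('X * p)%R <= k.+1)%N.
  move=> pk; rewrite mulrC; have [->|p0] := eqVneq p 0.
    by rewrite mul0r size_poly0.
  by rewrite size_mulX.
have sAB : (size (A + B)%R <= n.+1)%N.
  by rewrite (leq_trans (size_polyD _ _))// geq_max sA ltnW.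
have sAXB : (size (A + 'X * B)%R <= n.+1)%N.
  by rewrite (leq_trans (size_polyD _ _))// geq_max sA sX.
split; rewrite (leq_trans (size_polyD _ _))// geq_max.
  by rewrite ltnW//= sX.
by rewrite sAXB.
Qed.

Lemma horner_binomial_parts m (y : R) :
  (binomial_parts m).1.[y ^+ 2] + y * (binomial_parts m).2.[y ^+ 2] =
  (1 + y) ^+ m.
Proof.
elim: m => [|m]; first by rewrite /= hornerC horner0 mulr0 addr0.
rewrite /=; case: (binomial_parts m) => A B /= IH.
by rewrite [RHS]exprS -IH !hornerE; ring.
Qed.

Lemma horner_even_part n (y : R) :
  (binomial_parts n.*2).1.[y ^+ 2] = ((1 + y) ^+ n.*2 + (1 - y) ^+ n.*2) / 2.
Proof.
rewrite -(horner_binomial_parts _ (- y)) -(horner_binomial_parts _ y) sqrrN.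
by field.
Qed.

(** De Moivre's formula at [y = i tan x], where [y^2 = - tan^2 x], split into real and imaginary
    parts so that no complex number appears. *)
Lemma trig_binomial_parts m (x : R) : cos x != 0 ->
  cos x ^+ m * (binomial_parts m).1.[- tan x ^+ 2] = cos (x *+ m) /\
  cos x ^+ m * tan x * (binomial_parts m).2.[- tan x ^+ 2] = sin (x *+ m).
Proof.
move=> cx; have sE : sin x = cos x * tan x by rewrite /tan mulrC divfK.
elim: m => [|m].
  by rewrite /= !mulr0n cos0 sin0 hornerC horner0 !mulr0 mulr1.
rewrite /= mulrSr cosD sinD; case: (binomial_parts m) => A B /= [<- <-].
by rewrite sE !(hornerD, hornerM, hornerX) exprS; split; ring.
Qed.

Lemma root_even_part n (x : R) : cos x != 0 -> cos (x *+ n.*2) = 0 ->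
  root (binomial_parts n.*2).1 (- tan x ^+ 2).
Proof.
move=> cx c0; have [/eqP] := trig_binomial_parts n.*2 cx.
by rewrite c0 mulf_eq0 expf_eq0 (negbTE cx) andbF.
Qed.

(* The zeros of the even part are [- tan ^ 2] of these angles. *)
Definition even_angle (n j : nat) : R := (j.*2.-1)%:R * pi / (4 * n%:R).

Lemma even_angle_itv n j : (1 <= j <= n)%N ->
  0 < even_angle n j < pi / 2.
Proof.
move=> /andP[j1 jn]; have p0 := pi_gt0 R.
have n0 : 0 < n%:R :> R by rewrite ltr0n; lia.
rewrite /even_angle divr_gt0 ?mulr_gt0 ?ltr0n//; try lia.
rewrite ltr_pdivrMr ?mulr_gt0//.
have -> : j.*2.-1%:R = 2 * j%:R - 1 :> R.
  by rewrite -subn1 natrB -?muln2 ?natrM ?(mulrC 2)//; lia.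
have : 1 <= j%:R :> R by rewrite ler1n.
have : j%:R <= n%:R :> R by rewrite ler_nat.
move=> h1 h2; rewrite andTb.
have : 0 < (2 * n%:R - (2 * j%:R - 1)) * pi :> R by rewrite mulr_gt0//; lra.
by move=> *; lra.
Qed.

Lemma even_angle_lt n i j : (0 < n)%N -> (0 < i)%N ->
  (even_angle n i < even_angle n j) = (i < j)%N.
Proof.
move=> n0 i0; have p0 := pi_gt0 R.
have n0' : 0 < n%:R :> R by rewrite ltr0n.
rewrite /even_angle ltr_pM2r ?invr_gt0 ?mulr_gt0// ltr_pM2r// ltr_nat.
by apply/idP/idP; lia.
Qed.

Lemma cos_even_angle_gt0 n j : (1 <= j <= n)%N -> 0 < cos (even_angle n j).
Proof.
move=> /even_angle_itv/andP[h1 h2]; apply: cos_gt0_pihalf.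
by rewrite h2 andbT (lt_trans _ h1)// oppr_lt0 divr_gt0 ?pi_gt0.
Qed.

Lemma cosMpi_odd m : cos (m.*2.+1%:R * pi / 2 : R) = 0.
Proof.
elim: m => [|m IH]; first by rewrite mul1r cos_pihalf.
have -> : m.+1.*2.+1%:R * pi / 2 = m.*2.+1%:R * pi / 2 + pi :> R.
  by rewrite doubleS -[m.*2.+3]addn2 natrD; field.
by rewrite cosDpi IH oppr0.
Qed.

(** For a zero [- tan^2 x] the quantity [1 / (1 - rho)] is [1 / (1 + tan^2 x) = cos^2 x]. *)
Lemma ln_even_part_ratio n (z : R) : 0 <= z -> (0 < n)%N ->
  0 < (binomial_parts n.*2).1.[1] -> 0 < (binomial_parts n.*2).1.[1 + z] ->
  ln (binomial_parts n.*2).1.[1 + z] - ln (binomial_parts n.*2).1.[1] =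
  \sum_(1 <= j < n.+1) ln (1 + z * cos (even_angle n j) ^+ 2).
Proof.
move=> z0 n0 P1 Pz.
rewrite (@ln_root_ratio _ _ n (fun j => - tan (even_angle n j) ^+ 2))//.
- apply: eq_big_nat => j hj; have := cos_even_angle_gt0 hj => c0.
  by rewrite opprK -cos2_tan2 ?gt_eqF// invrK.
- exact: (size_binomial_parts n).1.
(* The zeros are distinct because [tan] is positive and injective on these angles, so its squares
   differ. *)
- have ht j : (1 <= j <= n)%N -> 0 < tan (even_angle n j).
    move=> hj; have /andP[h1 h2] := even_angle_itv hj.
    by rewrite divr_gt0 ?cos_even_angle_gt0// sin_gt0_pihalf// h1.
  move=> i j hi hj /oppr_inj/eqP; rewrite eqrXn2 ?ltW ?ht// => /eqP/tan_inj e.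
  have itv k : (1 <= k <= n)%N -> even_angle n k \in `](- (pi / 2)), (pi / 2)[.
    move=> /even_angle_itv/andP[h1 h2]; rewrite in_itv /= h2 andbT.
    by rewrite (lt_trans _ h1)// oppr_lt0 divr_gt0 ?pi_gt0.
  have {}e := e (itv i hi) (itv j hj).
  have [i0 j0] : (0 < i)%N /\ (0 < j)%N by case/andP: hi; case/andP: hj.
  have hij : (i < j)%N = false by rewrite -(even_angle_lt j n0 i0) e ltxx.
  have hji : (j < i)%N = false by rewrite -(even_angle_lt i n0 j0) e ltxx.
  by move=> {e ht itv}; apply: anti_leq; rewrite (leqNgt i) hji (leqNgt j) hij.
- move=> j hj; apply: root_even_part; first by rewrite gt_eqF ?cos_even_angle_gt0.
  rewrite -[RHS](cosMpi_odd j.-1); congr cos; rewrite /even_angle -[_ *+ n.*2]mulr_natr.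
  have -> : (j.-1.*2.+1 = j.*2.-1)%N by case/andP: hj; lia.
  rewrite -(muln2 n) natrM; field.
  by rewrite pnatr_eq0; lia.
- move=> j hj; have := cos_even_angle_gt0 hj => c0.
  have /andP[h1 h2] := even_angle_itv hj.
  by rewrite oppr_lt0 exprn_gt0// divr_gt0// sin_gt0_pihalf// h1.
Qed.

Lemma even_part_bounds n (y : R) : 0 <= y ->
  (1 + y) ^+ n.*2 / 2 <= (binomial_parts n.*2).1.[y ^+ 2] <= (1 + y) ^+ n.*2.
Proof.
move=> y0; rewrite horner_even_part.
have h1 : 0 <= (1 - y) ^+ n.*2 by rewrite -mul2n mulnC exprM sqr_ge0.
have h2 : (1 - y) ^+ n.*2 <= (1 + y) ^+ n.*2.
  rewrite -mul2n !exprM lerXn2r ?nnegrE ?sqr_ge0//; nra.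
by apply/andP; split; lra.
Qed.

End EvenPart.

(** * Two-sided bounds up to factors polynomial in [n] *)

Section SegreBounds.
Variable R : realType.

(** Each of the [kappa] unit increments of the upper index costs a factor at most [n + kappa]. *)
Lemma bin_shift_le n kappa k : (k <= n)%N ->
  ('C(n + kappa, k) <= (n + kappa) ^ kappa * 'C(n, k))%N.
Proof.
move=> kn; elim: kappa => [|kp IH]; first by rewrite addn0 expn0 mul1n.
have h1 : ('C((n + kp).+1, k) <= (n + kp).+1 * 'C(n + kp, k))%N.
  rewrite -[X in (_ <= X * _)%N]/(_.+1.-1.+1) mul_bin_down /=.
  by rewrite leq_pmull// subn_gt0; lia.
rewrite addnS (leq_trans h1)// expnS -mulnA leq_pmul2l// (leq_trans IH)//.
rewrite leq_mul2r; apply/orP; right.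
by case: (posnP kp) => [->//|kp0]; rewrite leq_exp2r.
Qed.

Lemma sqr_sum_le (n : nat) (a : nat -> R) :
  (\sum_(i < n) a i) ^+ 2 <= n%:R * \sum_(i < n) a i ^+ 2.
Proof.
elim: n => [|n IH]; first by rewrite !big_ord0 expr0n mul0r.
rewrite !big_ord_recr /=; set x := a n.
set S := \sum_(i < n) a i in IH *; set Q := \sum_(i < n) a i ^+ 2 in IH *.
(* This sum of squares is exactly the slack that the induction step of Cauchy-Schwarz needs. *)
have : 0 <= \sum_(i < n) (a i - x) ^+ 2 by apply: sumr_ge0 => i _; exact: sqr_ge0.
have -> : \sum_(i < n) (a i - x) ^+ 2 = Q - 2 * x * S + n%:R * x ^+ 2.
  rewrite (eq_bigr (fun i : 'I_n => a i ^+ 2 - 2 * x * a i + x ^+ 2)).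
    by rewrite big_split /= sumrB -mulr_sumr sumr_const card_ord [n%:R * _]mulr_natl.
  by move=> i _; ring.
by rewrite -natr1 => h; lra.
Qed.

Lemma sum_sqr_le (n : nat) (a : nat -> R) : (forall i, 0 <= a i) ->
  \sum_(i < n) a i ^+ 2 <= (\sum_(i < n) a i) ^+ 2.
Proof.
move=> a0; elim: n => [|n IH]; first by rewrite !big_ord0 expr0n.
rewrite !big_ord_recr /= sqrrD lerD2r ler_wpDr// mulrn_wge0// mulr_ge0//.
exact: sumr_ge0.
Qed.

Lemma binomial_sum n (y : R) :
  (1 + y) ^+ n = \sum_(k < n.+1) 'C(n, k)%:R * y ^+ k.
Proof.
by rewrite exprDn; apply: eq_bigr => k _; rewrite expr1n mul1r mulr_natl.
Qed.

Definition segre_numerator (n kappa : nat) : {poly R} :=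
  \poly_(k < n.+1) ('C(n, k) * 'C(n + kappa, k))%:R.

(** Up to the factor of [bin_shift_le], the value at [y^2] is the sum of the squares of the terms of
    [(1 + y)^n]. That sum lies between the square of the sum divided by [n + 1] and the square of
    the sum. *)
Lemma segre_numerator_bounds n kappa (y : R) : 0 <= y ->
  (1 + y) ^+ n.*2 <= n.+1%:R * (segre_numerator n kappa).[y ^+ 2] /\
  (segre_numerator n kappa).[y ^+ 2] <= ((n + kappa) ^ kappa)%:R * (1 + y) ^+ n.*2.
Proof.
move=> y0; rewrite /segre_numerator horner_poly -mul2n mulnC exprM binomial_sum.
have a0 k : 0 <= 'C(n, k)%:R * y ^+ k by rewrite mulr_ge0// exprn_ge0.
split.
  rewrite (le_trans (sqr_sum_le n.+1 (fun k => 'C(n, k)%:R * y ^+ k)))// ler_pM2l ?ltr0n//.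
  apply: ler_sum => k _; rewrite exprMn -!exprM mulnC natrM.
  rewrite ler_wpM2r ?exprn_ge0// expr2 ler_wpM2l// ler_nat.
  by rewrite leq_bin2l ?leq_addr.
rewrite (le_trans _ (ler_wpM2l _ (@sum_sqr_le n.+1 (fun k => 'C(n, k)%:R * y ^+ k) a0)))// mulr_sumr.
apply: ler_sum => k _ /=; rewrite [(_ * y ^+ k) ^+ 2]exprMn -!exprM [(k * 2)%N]mulnC mulrA.
rewrite ler_wpM2r ?exprn_ge0// expr2 -!natrM ler_nat.
by rewrite mulnCA leq_mul2l bin_shift_le ?orbT// -ltnS.
Qed.

Lemma ln_dist_le (c X Y : R) : 1 <= c -> 0 < Y -> Y <= c * X -> X <= c * Y ->
  0 < X /\ `|ln X - ln Y| <= ln c.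
Proof.
move=> c1 Y0 YX XY; have c0 : 0 < c by lra.
have X0 : 0 < X by have := lt_le_trans Y0 YX; rewrite pmulr_rgt0.
split => //; rewrite ler_distl lerBlDr -!lnM ?posrE//.
by rewrite !ler_ln ?posrE ?mulr_gt0// [X * c]mulrC [Y * c]mulrC YX.
Qed.

Lemma segre_numerator_ln n kappa (y : R) : 0 <= y -> (0 < n)%N ->
  0 < (segre_numerator n kappa).[y ^+ 2] /\
  `|ln (segre_numerator n kappa).[y ^+ 2] - ln ((1 + y) ^+ n.*2)| <=
    ln ((n + kappa).+1%:R ^+ kappa.+1).
Proof.
move=> y0 n0; have [h1 h2] := segre_numerator_bounds n kappa y0.
have Y0 : 0 < (1 + y) ^+ n.*2 by rewrite exprn_gt0//; lra.
apply: ln_dist_le => //; first by rewrite exprn_ege1// ler1n.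
  (* Enlarging the factor [n + 1] to the common constant requires a nonnegative value; a negative
     one contradicts [h1]. *)
  have [P0|P0] := leP 0 (segre_numerator n kappa).[y ^+ 2].
    rewrite (le_trans h1)// ler_wpM2r// -natrX ler_nat expnS.
    by rewrite (leq_trans _ (leq_pmulr _ _)) ?expn_gt0//; lia.
  by have := lt_le_trans Y0 h1; rewrite pmulr_rgt0 ?ltr0n// ltNge (ltW P0).
rewrite (le_trans h2)// ler_wpM2r ?(ltW Y0)// -natrX ler_nat.
rewrite expnS (leq_trans _ (leq_pmull _ _))//.
by case: (posnP kappa) => [->//|kp0]; rewrite leq_exp2r.
Qed.

Lemma even_part_ln n kappa (y : R) : 0 <= y -> (0 < n)%N ->
  0 < (binomial_parts R n.*2).1.[y ^+ 2] /\
  `|ln (binomial_parts R n.*2).1.[y ^+ 2] - ln ((1 + y) ^+ n.*2)| <=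
    ln ((n + kappa).+1%:R ^+ kappa.+1).
Proof.
move=> y0 n0; have /andP[h1 h2] := even_part_bounds n y0.
have Y0 : 0 < (1 + y) ^+ n.*2 by rewrite exprn_gt0//; lra.
have c2 : 2 <= (n + kappa).+1%:R ^+ kappa.+1 :> R.
  rewrite -natrX ler_nat expnS (leq_trans _ (leq_pmulr _ _)) ?expn_gt0//; lia.
by apply: ln_dist_le => //; nra.
Qed.

(** The 4 counts the comparisons with [(1 + y)^(2n)]: two polynomials, each at the two points [1]
    and [1 + z]. The powers of [1 + y] themselves cancel. *)
Lemma log_gap n kappa (rho : nat -> R) (z : R) : 0 <= z -> (0 < n)%N ->
  {in [pred j | 1 <= j <= n]%N &, injective rho} ->
  (forall j, (1 <= j <= n)%N -> root (segre_numerator n kappa) (rho j)) ->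
  (forall j, (1 <= j <= n)%N -> rho j < 0) ->
  `|\sum_(1 <= j < n.+1) ln (1 + z * (1 - rho j)^-1) -
    \sum_(1 <= j < n.+1) ln (1 + z * cos (even_angle R n j) ^+ 2)| <=
  4 * kappa.+1%:R * ln (n + kappa).+1%:R.
Proof.
move=> z0 n0 irho Prho rho0.
have y0 : 0 <= Num.sqrt (1 + z) by exact: sqrtr_ge0.
have yE : Num.sqrt (1 + z) ^+ 2 = 1 + z by rewrite sqr_sqrtr//; lra.
have [P1 P1ln] := segre_numerator_ln kappa ler01 n0.
have [Pz Pzln] := segre_numerator_ln kappa y0 n0.
have [Q1 Q1ln] := even_part_ln kappa ler01 n0.
have [Qz Qzln] := even_part_ln kappa y0 n0.
rewrite expr1n in P1 P1ln Q1 Q1ln; rewrite yE in Pz Pzln Qz Qzln.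
rewrite -(ln_root_ratio z0 _ irho Prho rho0 P1 Pz) ?size_poly//.
rewrite -ln_even_part_ratio//.
rewrite -mulrA [kappa.+1%:R * _]mulr_natl -lnXn ?ltr0n//.
move: P1ln Pzln Q1ln Qzln; rewrite !ler_norml.
by move=> /andP[? ?] /andP[? ?] /andP[? ?] /andP[? ?]; apply/andP; split; lra.
Qed.

End SegreBounds.

(** * Moments and quantiles *)

Section Moments.
Variable R : realType.

Definition ln_taylor (K : nat) : {poly R} :=
  \sum_(k < K) ((-1) ^+ k / k.+1%:R) *: 'X^(k.+1).

Lemma horner_ln_taylor K (x : R) :
  (ln_taylor K).[x] = \sum_(k < K) (-1) ^+ k / k.+1%:R * x ^+ k.+1.
Proof.
rewrite /ln_taylor horner_sum; apply: eq_bigr => k _.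
by rewrite hornerZ hornerXn.
Qed.

Lemma deriv_ln_taylor K (x : R) :
  (ln_taylor K)^`().[x] * (1 + x) = 1 - (- x) ^+ K.
Proof.
elim: K => [|K IH]; first by rewrite /ln_taylor big_ord0 deriv0 horner0 mul0r subrr.
rewrite /ln_taylor big_ord_recr /= derivD derivZ derivXn hornerD mulrDl IH.
rewrite hornerZ hornerMn hornerXn /= -[_ *+ _]mulr_natr exprS.
have K0 : K.+1%:R != 0 :> R by rewrite pnatr_eq0.
rewrite -[x ^+ K]mul1r -(mulN1r x) !exprMn mul1r.
by field.
Qed.

(** The error has derivative [(- y)^K / (1 + y)], a geometric remainder bounded by [x^K] on
    [[0, x]]; the mean value theorem supplies the last factor [x]. *)
Lemma ln_taylor_le K (x : R) : 0 <= x ->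
  `|ln (1 + x) - (ln_taylor K).[x]| <= x ^+ K.+1.
Proof.
move=> x0; pose f (y : R) := ln (1 + y) - (ln_taylor K).[y].
pose df (y : R) := (1 + y)^-1 - (ln_taylor K)^`().[y].
have fd (y : R) : 0 <= y -> is_derive y (1 : R) f (df y).
  move=> y0; have y1 : 0 < 1 + y by lra.
  apply: is_deriveB; apply: trigger_derive.
    apply: is_derive1_comp; exact: is_derive1_ln.
  by rewrite add0r mulr1.
have [||c] := @MVT_segment R f df 0 x x0.
- by move=> y; rewrite in_itv /= => /andP[/ltW + _]; exact: fd.
- apply: derivable_within_continuous => y; rewrite in_itv /= => /andP[y0 _].
  by have [] := fd y y0.
rewrite in_itv /= => /andP[c0 cx].
have f0 : f 0 = 0.
  rewrite /f addr0 ln1 sub0r horner_ln_taylor big1 ?oppr0// => k _.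
  by rewrite expr0n mulr0.
rewrite f0 !subr0 -/(f x) => ->; rewrite normrM (ger0_norm x0) exprSr.
rewrite ler_wpM2r//.
have c1 : 0 < 1 + c by lra.
have -> : df c = (- c) ^+ K / (1 + c).
  apply: (@mulIf _ (1 + c)); first by rewrite gt_eqF.
  by rewrite /df mulrBl deriv_ln_taylor mulVf ?gt_eqF// divfK ?gt_eqF//; ring.
rewrite normrM normrX normrN (ger0_norm c0) normfV (gtr0_norm c1).
rewrite ler_pdivrMr// (@le_trans _ _ (x ^+ K))//.
  by rewrite lerXn2r ?nnegrE.
by rewrite ler_peMr ?exprn_ge0//; lra.
Qed.

Lemma cvg_sum0 (K : nat) (u : nat -> nat -> R) :
  (forall k, (k < K)%N -> u k n @[n --> \oo] --> (0 : R)) ->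
  \sum_(k < K) u k n @[n --> \oo] --> (0 : R).
Proof.
elim: K => [|K IH] uK.
  by under eq_fun do rewrite big_ord0; exact: cvg_cst.
under eq_fun do rewrite big_ord_recr /=.
have h : \sum_(k < K) u k n @[n --> \oo] --> (0 : R).
  by apply: IH => k kK; apply: uK; rewrite ltnS ltnW.
by have := cvgD h (uK K (ltnSn K)); rewrite addr0; exact.
Qed.

(* Indices run from 1; the average over [n = 0] indices is 0. *)
Definition avg (n : nat) (F : nat -> R) : R :=
  n%:R^-1 * \sum_(1 <= j < n.+1) F j.

Lemma avg_le n (F G : nat -> R) : (forall j, (1 <= j <= n)%N -> F j <= G j) ->
  avg n F <= avg n G.
Proof.
move=> FG; rewrite /avg ler_wpM2l ?invr_ge0// big_nat [leRHS]big_nat.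
exact: ler_sum.
Qed.

Lemma avgD n (F G : nat -> R) : avg n (fun j => F j + G j) = avg n F + avg n G.
Proof. by rewrite /avg big_split mulrDr. Qed.

Lemma avgZ n c (F : nat -> R) : avg n (fun j => c * F j) = c * avg n F.
Proof. by rewrite /avg -mulr_sumr mulrCA. Qed.

Lemma avg_sum n K (F : 'I_K -> nat -> R) :
  avg n (fun j => \sum_(k < K) F k j) = \sum_(k < K) avg n (F k).
Proof. by rewrite /avg exchange_big mulr_sumr. Qed.

Lemma avg_cst_le n (c : R) : 0 <= c -> avg n (fun=> c) <= c.
Proof.
move=> c0; rewrite /avg sumr_const_nat subn1 -[c *+ _]mulr_natl mulrA.
case: n => [|n]; first by rewrite mulr0 mul0r.
by rewrite mulVf ?mul1r// pnatr_eq0.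
Qed.

Lemma avg_norm_le n (F : nat -> R) (c : R) : 0 <= c ->
  (forall j, (1 <= j <= n)%N -> `|F j| <= c) -> `|avg n F| <= c.
Proof.
move=> c0 Fc; apply: le_trans (avg_cst_le n c0); rewrite /avg normrM.
rewrite ger0_norm ?invr_ge0// ler_wpM2l ?invr_ge0//.
rewrite (le_trans (ler_norm_sum _ _ _))// big_nat [leRHS]big_nat.
exact: ler_sum.
Qed.

Section TwoArrays.
Variables (w v : nat -> nat -> R).
Hypothesis w01 : forall n j, (1 <= j <= n)%N -> 0 <= w n j <= 1.
Hypothesis v01 : forall n j, (1 <= j <= n)%N -> 0 <= v n j <= 1.
Hypothesis ln_cvg : forall z, 0 < z < 1 ->
  avg n (fun j => ln (1 + z * w n j) - ln (1 + z * v n j)) @[n --> \oo] --> (0 : R).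

Lemma ln_avg_taylor K n (z : R) : 0 <= z ->
  `|avg n (fun j => ln (1 + z * w n j) - ln (1 + z * v n j)) -
    \sum_(k < K) (-1) ^+ k / k.+1%:R * z ^+ k.+1 *
       avg n (fun j => w n j ^+ k.+1 - v n j ^+ k.+1)| <= 2 * z ^+ K.+1.
Proof.
move=> z0; under eq_bigr do rewrite -avgZ.
rewrite -avg_sum -[X in _ - X]mul1r -mulNr -avgZ -avgD.
apply: avg_norm_le => [|j hj]; first by rewrite mulr_ge0// exprn_ge0.
have hx (x : R) : 0 <= x <= 1 ->
    `|ln (1 + z * x) - (ln_taylor K).[z * x]| <= z ^+ K.+1.
  move=> /andP[x0 x1]; rewrite (le_trans (ln_taylor_le K _)) ?mulr_ge0//.
  by rewrite exprMn ler_piMr ?exprn_ge0// exprn_ile1.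
rewrite [X in `|X| <= _](_ : _ = (ln (1 + z * w n j) - (ln_taylor K).[z * w n j]) -
   (ln (1 + z * v n j) - (ln_taylor K).[z * v n j])).
  rewrite (le_trans (ler_normB _ _))// mulr_natl mulr2n.
  by rewrite lerD ?hx ?w01 ?v01.
rewrite !horner_ln_taylor mulN1r.
rewrite (eq_bigr (fun k : 'I_K => (-1) ^+ k / k.+1%:R * (z * w n j) ^+ k.+1 -
   (-1) ^+ k / k.+1%:R * (z * v n j) ^+ k.+1)).
  by rewrite sumrB; ring.
by move=> k _; rewrite !exprMn; ring.
Qed.

(** Moments are extracted one at a time: once the lower ones are known to vanish in the limit, the
    term in [z^(K + 1)] is isolated up to [2 z^(K + 2)]. Taking [z] small, before [n] grows,
    replaces differentiation at [z = 0]. *)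
Lemma moment_cvg k :
  avg n (fun j => w n j ^+ k.+1 - v n j ^+ k.+1) @[n --> \oo] --> (0 : R).
Proof.
elim/ltn_ind: k => K IH; apply/cvgr0Pnorm_le => e e0.
have K0 : 0 < K.+1%:R :> R by rewrite ltr0n.
(* Chosen so that [2 z^(K + 2)] is at most [e / 2] times the size [z^(K + 1) / (K + 1)] of the
   coefficient [c]. *)
have [z /andP[z0 z1] Kz] : exists2 z : R, 0 < z < 1 & 4 * K.+1%:R * z <= e.
  exists (Num.min (1 / 2) (e / (4 * K.+1%:R))).
    by rewrite lt_min gt_min divr_gt0 ?mulr_gt0//=; lra.
  by rewrite -ler_pdivlMl ?mulr_gt0// ge_min [_^-1 * e]mulrC lexx orbT.
have zK : 0 < z ^+ K.+1 by rewrite exprn_gt0.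
pose c := (-1) ^+ K / K.+1%:R * z ^+ K.+1 : R.
have normc : `|c| = z ^+ K.+1 / K.+1%:R.
  rewrite /c !normrM normrX normrN normr1 expr1n mul1r.
  by rewrite normfV !ger0_norm 1?mulrC// ?ltW.
pose S n := avg n (fun j => ln (1 + z * w n j) - ln (1 + z * v n j)) -
    \sum_(k < K) (-1) ^+ k / k.+1%:R * z ^+ k.+1 *
       avg n (fun j => w n j ^+ k.+1 - v n j ^+ k.+1).
have S0 : S n @[n --> \oo] --> (0 : R).
  have h1 := ln_cvg (introT andP (conj z0 z1)).
  suff h2 : \sum_(k < K) (-1) ^+ k / k.+1%:R * z ^+ k.+1 *
       avg n (fun j => w n j ^+ k.+1 - v n j ^+ k.+1) @[n --> \oo] --> (0 : R).
    by have := cvgB h1 h2; rewrite subr0; exact.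
  apply: (@cvg_sum0 K (fun k n => (-1) ^+ k / k.+1%:R * z ^+ k.+1 *
       avg n (fun j => w n j ^+ k.+1 - v n j ^+ k.+1))) => k kK.
  have := cvgMl_tmp (a := (-1) ^+ k / k.+1%:R * z ^+ k.+1) (IH k kK).
  by rewrite mulr0; exact.
have e' : 0 < e / 2 * `|c| by rewrite normc mulr_gt0 ?divr_gt0.
move/cvgr0Pnorm_le/(_ _ e') : S0; apply: filterS => n Sn.
have := ln_avg_taylor K.+1 n (ltW z0).
rewrite big_ord_recr /= -/c opprD addrA -/(S n).
set d := avg n _ => hd.
have hcd : `|c| * `|d| <= e / 2 * `|c| + 2 * z ^+ K.+2.
  rewrite -normrM; have -> : c * d = S n - (S n - c * d) by ring.
  by rewrite (le_trans (ler_normB _ _))// lerD.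
have : 2 * z ^+ K.+2 <= e / 2 * `|c|.
  have -> : 2 * z ^+ K.+2 = `|c| * (2 * K.+1%:R * z).
    rewrite normc exprSr; have := gt_eqF K0; move/negbT => K0'.
    by field.
  by rewrite [leRHS]mulrC ler_wpM2l//; lra.
have c0 : 0 < `|c| by rewrite normc divr_gt0.
move=> h; rewrite -(ler_pM2l c0); lra.
Qed.

Lemma avg_horner_cvg (Q : {poly R}) :
  avg n (fun j => Q.[w n j] - Q.[v n j]) @[n --> \oo] --> (0 : R).
Proof.
have -> : (fun n => avg n (fun j => Q.[w n j] - Q.[v n j])) =
  fun n => \sum_(k < size Q) Q`_k * avg n (fun j => w n j ^+ k - v n j ^+ k).
  apply/funext => n; under [RHS]eq_bigr do rewrite -avgZ.
  rewrite -avg_sum /avg; congr (_ * _); apply: eq_bigr => j _.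
  by rewrite !horner_coef -sumrB; apply: eq_bigr => k _; rewrite mulrBr.
apply: (@cvg_sum0 _ (fun k n => Q`_k * avg n (fun j => w n j ^+ k - v n j ^+ k))).
move=> k _; suff h : avg n (fun j => w n j ^+ k - v n j ^+ k) @[n --> \oo] --> (0 : R).
  by have := cvgMl_tmp (a := Q`_k) h; rewrite mulr0; exact.
case: k => [|k]; last exact: moment_cvg.
rewrite (_ : (fun n => _) = fun=> 0); first exact: cvg_cst.
by apply/funext => n; rewrite /avg big1 ?mulr0// => j _; rewrite !expr0 subrr.
Qed.

End TwoArrays.

End Moments.

(** * From moments to the number of points above a threshold *)

Section Counting.
Variable R : realType.

Lemma bernoulli_le (x : R) (m : nat) : 0 <= x <= 1 ->
  1 - m%:R * x <= (1 - x) ^+ m.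
Proof.
move=> /andP[x0 x1]; elim: m => [|m IH]; first by rewrite mul0r subr0.
rewrite exprSr (@le_trans _ _ ((1 - m%:R * x) * (1 - x)))//.
  have : 0 <= m%:R * x * x by rewrite !mulr_ge0.
  by rewrite -natr1; lra.
by rewrite ler_wpM2r// subr_ge0.
Qed.

Lemma bernoulli_ge (x : R) (m : nat) : 0 <= x -> 1 + m%:R * x <= (1 + x) ^+ m.
Proof.
move=> x0; elim: m => [|m IH]; first by rewrite mul0r addr0.
rewrite exprSr (@le_trans _ _ ((1 + m%:R * x) * (1 + x)))//.
  have : 0 <= m%:R * x * x by rewrite !mulr_ge0.
  by rewrite -natr1; lra.
by rewrite ler_wpM2r// addr_ge0.
Qed.

Lemma bernoulli_inv (x : R) (m : nat) : 0 <= x <= 1 ->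
  (1 - x) ^+ m * (1 + m%:R * x) <= 1.
Proof.
move=> /andP[x0 x1].
rewrite (@le_trans _ _ ((1 - x) ^+ m * (1 + x) ^+ m))//.
  by rewrite ler_wpM2l ?bernoulli_ge// exprn_ge0// subr_ge0.
by rewrite -exprMn exprn_ile1//; nra.
Qed.

(* [1 - (1 - x^N)^M] with [M] of the order of [c^-N], [a < c < b], as in the
   Brosowski-Deutsch proof of the Stone-Weierstrass theorem. *)
Lemma step_polynomial (a b e : R) : 0 <= a -> a < b -> b <= 1 -> 0 < e ->
  exists Q : {poly R},
    [/\ forall x, 0 <= x <= 1 -> 0 <= Q.[x] <= 1,
        forall x, 0 <= x <= a -> Q.[x] <= e
      & forall x, b <= x <= 1 -> 1 - e <= Q.[x]].
Proof.
move=> a0 ab b1 e0; pose c := (a + b) / 2.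
have [c0 c1 b0] : [/\ 0 < c, c < 1 & 0 < b] by rewrite /c; split; lra.
(* The half in the first bound absorbs the factor 2 in [M <= 2 c^(-N)], which comes from rounding
   [c^(-N) >= 1] up to an integer. *)
have [N [Na Nb]] : exists N : nat, (a / c) ^+ N <= e / 2 /\ (c / b) ^+ N <= e.
  have [ac0 cb0] : 0 <= a / c /\ 0 <= c / b by split; apply: divr_ge0; lra.
  have ac : `|a / c| < 1.
    by rewrite (ger0_norm ac0) ltr_pdivrMr//; rewrite /c; lra.
  have cb : `|c / b| < 1.
    by rewrite (ger0_norm cb0) ltr_pdivrMr//; rewrite /c; lra.
  have e2 : 0 < e / 2 by rewrite divr_gt0.
  have /cvgr0Pnorm_le/(_ _ e2) h1 := cvg_expr ac.
  have /cvgr0Pnorm_le/(_ _ e0) h2 := cvg_expr cb.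
  have [N [hN1 hN2]] := filter_ex (filterI h1 h2); exists N; split.
    by rewrite (le_trans (ler_norm _))//; exact: hN1.
  by rewrite (le_trans (ler_norm _))//; exact: hN2.
have cN : 0 < c ^+ N by rewrite exprn_gt0.
pose M := (Num.truncn (c ^- N)).+1.
have M1 : c ^- N <= M%:R by apply/ltW; exact: truncnS_gt.
have M2 : M%:R <= 2 * c ^- N.
  have : (Num.truncn (c ^- N))%:R <= c ^- N by rewrite truncn_le// invr_ge0 ltW.
  have : 1 <= c ^- N by rewrite invf_ge1// exprn_ile1// ltW.
  by rewrite /M -natr1; lra.
exists (1 - (1 - 'X^N) ^+ M).
have QE x : (1 - (1 - 'X^N) ^+ M : {poly R}).[x] = 1 - (1 - x ^+ N) ^+ M.
  by rewrite !(hornerD, hornerN, horner_exp, hornerC, hornerXn) hornerX.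
have xN (x : R) : 0 <= x <= 1 -> 0 <= x ^+ N <= 1.
  by move=> /andP[x0 x1]; rewrite exprn_ge0// exprn_ile1.
split=> x hx; rewrite QE.
- have /andP[y0 y1] := xN x hx.
  have z0 : 0 <= 1 - x ^+ N by rewrite subr_ge0.
  have z1 : 1 - x ^+ N <= 1 by rewrite gerBl.
  by rewrite subr_ge0 exprn_ile1//= gerBl exprn_ge0.
- have /andP[x0 xa] := hx.
  have hx1 : 0 <= x <= 1 by apply/andP; split; lra.
  have := bernoulli_le M (xN x hx1).
  have : M%:R * x ^+ N <= e.
    rewrite (@le_trans _ _ (2 * c ^- N * a ^+ N))//.
      by apply: ler_pM => //; rewrite ?exprn_ge0// lerXn2r// nnegrE.
    by move: Na; rewrite expr_div_n; lra.
  by lra.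
- have /andP[bx x1] := hx.
  have hx1 : 0 <= x <= 1 by apply/andP; split; lra.
  have /andP[y0 y1] := xN x hx1.
  have := bernoulli_inv M (xN x hx1).
  set p := (1 - x ^+ N) ^+ M => hp.
  have p0 : 0 <= p by rewrite exprn_ge0// subr_ge0.
  have bN : 0 < b ^+ N by rewrite exprn_gt0.
  have h : (b / c) ^+ N <= 1 + M%:R * x ^+ N.
    rewrite expr_div_n mulrC ler_wpDl//.
    apply: ler_pM => //; rewrite ?invr_ge0 ?exprn_ge0 ?(ltW c0) ?(ltW b0)//.
    by rewrite lerXn2r ?nnegrE ?(ltW b0)//; lra.
  have hq : 0 < (b / c) ^+ N by rewrite exprn_gt0// divr_gt0.
  have : p <= (c / b) ^+ N.
    rewrite -[c / b]invf_div exprVn -[leRHS]mul1r ler_pdivlMr//.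
    by rewrite (le_trans _ hp)// ler_wpM2l.
  by lra.
Qed.

Section TwoArrays.
Variables (w v : nat -> nat -> R).
Hypothesis w01 : forall n j, (1 <= j <= n)%N -> 0 <= w n j <= 1.
Hypothesis v01 : forall n j, (1 <= j <= n)%N -> 0 <= v n j <= 1.
Hypothesis ln_cvg : forall z, 0 < z < 1 ->
  avg n (fun j => ln (1 + z * w n j) - ln (1 + z * v n j)) @[n --> \oo] --> (0 : R).

(** A polynomial fits between the indicators of [[b, 1]] and [(a, 1]] up to [e / 3] on each side,
    and its averages over both arrays agree up to the third [e / 3]. The gap between [a] and [b]
    leaves a continuous function room to rise. *)
Lemma avg_count_le (a b e : R) : 0 <= a -> a < b -> b <= 1 -> 0 < e ->
  \forall n \near \oo,
    avg n (fun j => (b <= w n j)%R%:R) <= avg n (fun j => (a < v n j)%R%:R) + e.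
Proof.
move=> a0 ab b1 e0; have e3 : 0 < e / 3 by rewrite divr_gt0.
have [Q [Q01 Qa Qb]] := step_polynomial a0 ab b1 e3.
have /cvgr0Pnorm_le/(_ _ e3) := avg_horner_cvg w01 v01 ln_cvg Q.
apply: filterS => n hn.
have hw : avg n (fun j => (b <= w n j)%R%:R) <= avg n (fun j => Q.[w n j] + e / 3).
  apply: avg_le => j hj; have [bw|_] := leP b (w n j).
    by rewrite -lerBlDr Qb// bw; case/andP: (w01 hj).
  by rewrite addr_ge0 ?(ltW e3)//; case/andP: (Q01 _ (w01 hj)).
have hv : avg n (fun j => Q.[v n j]) <= avg n (fun j => (a < v n j)%R%:R + e / 3).
  apply: avg_le => j hj; have [av|va] := ltP a (v n j).
    by rewrite ler_wpDr ?(ltW e3)//; case/andP: (Q01 _ (v01 hj)).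
  by rewrite add0r Qa// va andbT; case/andP: (v01 hj).
have hQ : avg n (fun j => Q.[w n j]) =
    avg n (fun j => Q.[w n j] - Q.[v n j]) + avg n (fun j => Q.[v n j]).
  by rewrite -avgD; congr avg; apply/funext => j; rewrite subrK.
have := avg_cst_le n (ltW e3); rewrite !avgD in hw hv => he.
move: hn; rewrite ler_norml => /andP[_ hn]; lra.
Qed.

End TwoArrays.

End Counting.

(** * From counts to the point of a given index *)

Section Quantiles.
Variable R : realType.

Lemma avg_cst n (c : R) : (0 < n)%N -> avg n (fun=> c) = c.
Proof.
move=> n0; rewrite /avg sumr_const_nat subn1 -[c *+ _]mulr_natl mulrA.
by rewrite mulVf ?mul1r// pnatr_eq0 -lt0n.
Qed.

Lemma avg_count_lt n (X : R) : 0 <= X ->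
  avg n (fun i => (i%:R < X)%R%:R) <= X / n%:R.
Proof.
move=> X0; rewrite /avg mulrC ler_wpM2r ?invr_ge0//.
elim: n => [|n IH]; first by rewrite big_geq.
rewrite big_nat_recr//=; have [nX|_] := ltP n.+1%:R X; last by rewrite addr0.
rewrite (le_trans _ (ltW nX))// -[n.+1%:R]natr1 lerD// (@le_trans _ _ (\sum_(1 <= i < n.+1) 1))//.
  by apply: ler_sum => i _; rewrite lern1 leq_b1.
by rewrite sumr_const_nat subn1.
Qed.

Lemma avg_count_ge n (X : R) : X <= n.+1%:R ->
  (X - 1) / n%:R <= avg n (fun i => (i%:R <= X)%R%:R).
Proof.
rewrite /avg mulrC => Xn; rewrite ler_wpM2l ?invr_ge0//.
elim: n Xn => [|n IH] Xn; first by rewrite big_geq// subr_le0.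
rewrite big_nat_recr//=; have [nX|/ltW Xn'] := leP n.+1%:R X.
  rewrite big_nat (eq_bigr (fun=> 1)) => [|i hi].
    rewrite -big_nat sumr_const_nat subn1 /=.
    by move: Xn; rewrite -(natr1 n.+1) -(natr1 n); lra.
  by rewrite (le_trans _ nX)// ler_nat; lia.
by rewrite addr0 IH.
Qed.

Lemma cos_sqr_le (x y : R) : 0 <= x -> x <= y -> y <= pi / 2 ->
  cos y ^+ 2 <= cos x ^+ 2.
Proof.
move=> x0 xy y2; have p0 := pi_gt0 R.
have cy : 0 <= cos y by apply: cos_ge0_pihalf; apply/andP; split; lra.
have cxy : cos y <= cos x.
  by rewrite leNgt ltr_cos ?in_itv /=; [rewrite -leNgt|apply/andP; split; lra..].
by rewrite lerXn2r ?nnegrE// (le_trans cy).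
Qed.

(** The angle is [pi / 2] times the midpoint [(i - 1/2) / n] of the [i]-th cell, whence the shift by
    [1 / 2]. *)
Lemma even_angle_cmp n i (x : R) : (0 < n)%N -> (0 < i)%N ->
  (even_angle R n i <= pi * x / 2) = (i%:R <= n%:R * x + 1 / 2) /\
  (pi * x / 2 <= even_angle R n i) = (n%:R * x + 1 / 2 <= i%:R).
Proof.
move=> n0 i0; have p0 := pi_gt0 R.
have n0' : 0 < n%:R :> R by rewrite ltr0n.
have -> : even_angle R n i = pi / (2 * n%:R) * (i%:R - 1 / 2).
  rewrite /even_angle; have -> : i.*2.-1%:R = 2 * i%:R - 1 :> R.
    by rewrite -subn1 natrB -?muln2 ?natrM ?(mulrC 2)//; lia.
  by field; rewrite gt_eqF.
have -> : pi * x / 2 = pi / (2 * n%:R) * (n%:R * x) :> R.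
  by field; rewrite gt_eqF.
have h : 0 < pi / (2 * n%:R) :> R by rewrite divr_gt0// mulr_gt0.
by rewrite !(ler_pM2l h) lerBlDr lerBrDr.
Qed.

(** The quantile function of the arcsine law on [[0, 1]], equal to [sin^2 (pi u / 2)]. The
    reflection [1 - u] is there because [cos^2] of [even_angle] decreases with the index. *)
Definition limit_quantile (u : R) : R := cos (pi * (1 - u) / 2) ^+ 2.

Lemma continuous_limit_quantile : continuous limit_quantile.
Proof.
rewrite (_ : limit_quantile = (fun y => y ^+ 2) \o (cos \o (fun x => pi * (1 - x) / 2))) //.
move=> u; apply: continuous_comp; last exact: exprn_continuous.
apply: continuous_comp; last exact: continuous_cos.
apply: continuousM; last exact: cst_continuous.
apply: continuousM; first exact: cst_continuous.
by apply: continuousB; [exact: cst_continuous|exact: cvg_id].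
Qed.

Lemma cos_sqr_even_angle_gt n i (u : R) : 0 <= u <= 1 -> (1 <= i <= n)%N ->
  limit_quantile u < cos (even_angle R n i) ^+ 2 ->
  i%:R < n%:R * (1 - u) + 1 / 2.
Proof.
move=> /andP[u0 u1] hi; have /andP[i0 iN] := hi; have p0 := pi_gt0 R.
have /andP[_ hx] := even_angle_itv R hi.
apply: contraLR; rewrite -!leNgt.
rewrite -(even_angle_cmp (1 - u) (leq_trans i0 iN) i0).2 => h.
have x0 : 0 <= pi * (1 - u) / 2 by apply: divr_ge0 => //; apply: mulr_ge0; lra.
exact: (cos_sqr_le x0 h (ltW hx)).
Qed.

Lemma cos_sqr_even_angle_ge n i (u : R) : 0 <= u <= 1 -> (1 <= i <= n)%N ->
  i%:R <= n%:R * (1 - u) + 1 / 2 ->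
  limit_quantile u <= cos (even_angle R n i) ^+ 2.
Proof.
move=> /andP[u0 u1] hi; have /andP[i0 iN] := hi; have p0 := pi_gt0 R.
have /andP[hx _] := even_angle_itv R hi.
rewrite -(even_angle_cmp (1 - u) (leq_trans i0 iN) i0).1 => h.
apply: cos_sqr_le => //; first exact: ltW.
by have : 0 <= pi * u by [apply: mulr_ge0; lra]; lra.
Qed.

Lemma limit_quantile01 (u : R) : 0 <= limit_quantile u <= 1.
Proof.
by rewrite /limit_quantile sqr_ge0 cos2sin2 gerBl sqr_ge0.
Qed.

Lemma limit_quantile_lt (u u' : R) : 0 <= u -> u < u' -> u' <= 1 ->
  limit_quantile u < limit_quantile u'.
Proof.
move=> u0 uu u1; have p0 := pi_gt0 R.
have h1 : 0 <= pi * u by rewrite mulr_ge0// ltW.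
have h2 : 0 < pi * (u' - u) by rewrite mulr_gt0// subr_gt0.
have h3 : 0 <= pi * (1 - u') by rewrite mulr_ge0 ?subr_ge0// ltW.
have c0 : 0 <= cos (pi * (1 - u) / 2).
  by apply: cos_ge0_pihalf; apply/andP; split; lra.
have cc : cos (pi * (1 - u) / 2) < cos (pi * (1 - u') / 2).
  by rewrite ltr_cos ?in_itv /=; [lra | apply/andP; split; lra..].
by rewrite ltrXn2r// nnegrE ltW// (le_lt_trans c0).
Qed.

Section Convergence.
Variables (w : nat -> nat -> R) (j : nat -> nat) (u : R).
Hypothesis w01 : forall n j, (1 <= j <= n)%N -> 0 <= w n j <= 1.
Hypothesis w_le : forall n i j, (1 <= i)%N -> (i <= j)%N -> (j <= n)%N ->
  w n i <= w n j.
Hypothesis ln_cvg : forall z, 0 < z < 1 ->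
  avg n (fun j => ln (1 + z * w n j) -
                  ln (1 + z * cos (even_angle R n j) ^+ 2)) @[n --> \oo] --> (0 : R).
Hypothesis u01 : 0 < u < 1.
Hypothesis j_itv : forall n, (1 <= n)%N -> (1 <= j n <= n)%N.
Hypothesis j_cvg : (j n)%:R / n%:R @[n --> \oo] --> u.

Let v n j := cos (even_angle R n j) ^+ 2.

Let v01 n i : (1 <= i <= n)%N -> 0 <= v n i <= 1.
Proof.
by rewrite /v sqr_ge0 cos2sin2 gerBl sqr_ge0.
Qed.

Let inv_small (e : R) : 0 < e -> \forall n \near \oo, (0 < n)%N /\ n%:R^-1 <= e.
Proof.
move=> e0; near=> n; have n0 : (0 < n)%N by near: n; exact: nbhs_infty_gt.
split=> //; rewrite invf_ple ?posrE ?ltr0n//.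
by apply: ltW; near: n; exact: nbhs_infty_gtr.
Unshelve. all: by end_near. Qed.

(** Otherwise monotonicity puts all points of index at least [j n], a fraction near [1 - u], above
    the quantile at [u'], whereas only a fraction near [1 - c < 1 - u] of the comparison points
    exceeds the quantile at [c]. *)
Lemma quantile_lt (u' : R) : u < u' <= 1 ->
  \forall n \near \oo, w n (j n) < limit_quantile u'.
Proof.
case/andP: u01 => u0 u1 /andP[uu' u'1]; pose c := (u + u') / 2.
(* Here [c - u = 4e], while the errors from the counts, from [j n / n] and from the shift [1 / (2n)]
   add up to at most [5e / 2]. *)
have e0 : 0 < (u' - u) / 8 by rewrite divr_gt0// subr_gt0.
set e := (u' - u) / 8 in e0.
have /andP[q0 _] := limit_quantile01 c; have /andP[_ q1] := limit_quantile01 u'.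
have cu' : limit_quantile c < limit_quantile u'.
  by apply: limit_quantile_lt; rewrite /c; lra.
have H1 := avg_count_le w01 v01 ln_cvg q0 cu' q1 e0.
have /cvgrPdist_lt/(_ _ e0) H2 := j_cvg.
have H3 := inv_small e0.
near=> n; have [n0 ni] : (0 < n)%N /\ n%:R^-1 <= e by near: n.
have n0' : 0 < n%:R :> R by rewrite ltr0n.
have h1 : avg n (fun i => (limit_quantile u' <= w n i)%R%:R) <=
  avg n (fun i => (limit_quantile c < v n i)%R%:R) + e by near: n.
have : `|u - (j n)%:R / n%:R| < e by near: n.
rewrite ltr_distl => /andP[h2 _].
rewrite ltNge; apply/negP => hw.
have /andP[j0 jn] := j_itv n0.
have h3 : @avg R n (fun i => 1 + -1 * (i%:R < (j n)%:R :> R)%R%:R) <=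
  @avg R n (fun i => (limit_quantile u' <= w n i)%R%:R).
  apply: avg_le => i /andP[i0 iN]; rewrite ltr_nat.
  have [ij|ji] := ltnP i (j n); first by rewrite mulN1r subrr.
  by rewrite (le_trans hw (w_le j0 ji iN)) mulr0 addr0.
have h4 : @avg R n (fun i => (limit_quantile c < v n i)%R%:R) <=
    avg n (fun i => (i%:R < n%:R * (1 - c) + 1 / 2)%R%:R).
  apply: avg_le => i hi; case: (boolP (limit_quantile c < v n i)) => // hv.
  by rewrite (cos_sqr_even_angle_gt _ hi hv)//; rewrite /c; apply/andP; split; lra.
have h7 : 0 <= n%:R * (1 - c) by apply: mulr_ge0; [exact: ltW | rewrite /c; lra].
have h8 : 0 <= n%:R * (1 - c) + 1 / 2 by lra.
have h5 := avg_count_lt n h8.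
have h6 := @avg_count_lt n (j n)%:R (ler0n _ _).
rewrite avgD avgZ avg_cst// in h3.
rewrite mulrDl mulrAC mulfV ?gt_eqF// in h5.
have : c = (u + u') / 2 by [].
by rewrite /e in h1 h2 ni *; lra.
Unshelve. all: by end_near. Qed.

Lemma quantile_gt (u' : R) : 0 <= u' < u ->
  \forall n \near \oo, limit_quantile u' < w n (j n).
Proof.
case/andP: u01 => u0 u1 /andP[u'0 uu']; pose c := (u + u') / 2.
(* Now [u - c = 4e] faces [7e / 2], because the lower bound on a count gives up one more index. *)
have e0 : 0 < (u - u') / 8 by rewrite divr_gt0// subr_gt0.
set e := (u - u') / 8 in e0.
have /andP[q0 _] := limit_quantile01 u'; have /andP[_ q1] := limit_quantile01 c.
have cu' : limit_quantile u' < limit_quantile c.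
  by apply: limit_quantile_lt; rewrite /c; lra.
have ln_cvg' z : 0 < z < 1 ->
  avg n (fun j => ln (1 + z * v n j) - ln (1 + z * w n j)) @[n --> \oo] --> (0 : R).
  move=> /ln_cvg/cvgN; rewrite oppr0.
  rewrite (_ : - _ = (fun n => avg n (fun j => ln (1 + z * v n j) -
    ln (1 + z * w n j)))) //; apply/funext => n /=.
  rewrite -[LHS]mulN1r -avgZ; congr avg.
  by apply/funext => i; rewrite mulN1r opprB.
have H1 := avg_count_le v01 w01 ln_cvg' q0 cu' q1 e0.
have /cvgrPdist_lt/(_ _ e0) H2 := j_cvg.
have H3 := inv_small e0.
near=> n; have [n0 ni] : (0 < n)%N /\ n%:R^-1 <= e by near: n.
have n0' : 0 < n%:R :> R by rewrite ltr0n.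
have h1 : avg n (fun i => (limit_quantile c <= v n i)%R%:R) <=
  avg n (fun i => (limit_quantile u' < w n i)%R%:R) + e by near: n.
have : `|u - (j n)%:R / n%:R| < e by near: n.
rewrite ltr_distl => /andP[_ h2].
rewrite ltNge; apply/negP => hw.
have /andP[j0 jn] := j_itv n0.
have h3 : @avg R n (fun i => (limit_quantile u' < w n i)%R%:R) <=
    avg n (fun i => 1 + -1 * (i%:R <= (j n)%:R :> R)%R%:R).
  apply: avg_le => i /andP[i0 iN]; rewrite ler_nat.
  have [ij|ji] := leqP i (j n); last by rewrite mulr0 addr0 lern1 leq_b1.
  by rewrite ltNge (le_trans (w_le i0 ij jn) hw) mulN1r subrr.
have h4 : @avg R n (fun i => (i%:R <= n%:R * (1 - c) + 1 / 2)%R%:R) <=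
    avg n (fun i => (limit_quantile c <= v n i)%R%:R).
  apply: avg_le => i hi; case: (boolP (i%:R <= _)) => // hv.
  by rewrite (cos_sqr_even_angle_ge _ hi hv)//; rewrite /c; apply/andP; split; lra.
have h5 := @avg_count_ge n (n%:R * (1 - c) + 1 / 2).
have h6 := @avg_count_ge n (j n)%:R.
have {}h6 : ((j n)%:R - 1) / n%:R <= @avg R n (fun i => (i%:R <= (j n)%:R :> R)%R%:R).
  by apply: h6; rewrite ler_nat leqW.
rewrite avgD avgZ avg_cst// in h3.
have {}h5 : (n%:R * (1 - c) + 1 / 2 - 1) / n%:R <=
    @avg R n (fun i => (i%:R <= n%:R * (1 - c) + 1 / 2)%R%:R).
  apply: h5; have : 0 <= n%:R * c by apply: mulr_ge0; [exact: ltW | rewrite /c; lra].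
  by rewrite -[n.+1%:R]natr1; lra.
rewrite (_ : _ / n%:R = (1 - c) - 1 / 2 * n%:R^-1) in h5; last first.
  by field; rewrite gt_eqF.
have : 0 < n%:R^-1 :> R by rewrite invr_gt0.
move=> h8; rewrite mulrBl in h6; have : c = (u + u') / 2 by [].
by rewrite /e in h1 h2 ni *; lra.
Unshelve. all: by end_near. Qed.

Lemma quantile_cvg : w n (j n) @[n --> \oo] --> limit_quantile u.
Proof.
case/andP: u01 => u0 u1; apply/cvgrPdist_lt => e e0.
have /cvgrPdist_lt/(_ _ e0)[d /= d0 hd] := @continuous_limit_quantile u.
pose d' := Num.min (d / 2) (Num.min u (1 - u)).
have d'0 : 0 < d' by rewrite /d' !lt_min; apply/and3P; split; lra.
have [d'1 d'2 d'3] : [/\ d' < d, d' <= u & d' <= 1 - u].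
  rewrite /d' gt_min !ge_min !lexx !orbT; split=> //.
  by apply/orP; left; lra.
have hp : `|limit_quantile u - limit_quantile (u + d')| < e.
  by apply: hd; rewrite /ball /= opprD addrA subrr sub0r normrN gtr0_norm.
have hm : `|limit_quantile u - limit_quantile (u - d')| < e.
  by apply: hd; rewrite /ball /= opprB addrC subrK gtr0_norm.
have H1 : \forall n \near \oo, w n (j n) < limit_quantile (u + d').
  by apply: quantile_lt; apply/andP; split; lra.
have H2 : \forall n \near \oo, limit_quantile (u - d') < w n (j n).
  by apply: quantile_gt; apply/andP; split; lra.
apply: filterS2 H1 H2 => n h1 h2; move: hp hm; rewrite !ltr_norml.
by move=> /andP[? ?] /andP[? ?]; apply/andP; split; lra.
Qed.

End Convergence.

End Quantiles.

(** * Convergence of the zeros *)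

Section TrapezoidZeros.
Variable R : realType.

Lemma cvg_ln_div (kappa : nat) :
  ln (n + kappa).+1%:R / n%:R @[n --> \oo] --> (0 : R).
Proof.
apply/cvgr0Pnorm_le => e e0; pose d := e / 2.
have d0 : 0 < d by rewrite divr_gt0.
near=> n.
have n0 : 0 < n%:R :> R by near: n; exact: nbhs_infty_gtr.
have hn : (d * kappa.+1%:R - ln d) / d < n%:R by near: n; exact: nbhs_infty_gtr.
have N1 : 1 <= (n + kappa).+1%:R :> R by rewrite ler1n.
rewrite ger0_norm ?divr_ge0 ?ln_ge0 ?(ltW n0)// ler_pdivrMr//.
(* With [N = n + kappa + 1] this reads [ln N <= d N - 1 - ln d], a linear bound of slope [e / 2];
   the other half of [e] absorbs the constants for large [n]. *)
have : ln (1 + (d * (n + kappa).+1%:R - 1)) <= d * (n + kappa).+1%:R - 1.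
  apply: le_ln1Dx; have : 0 < d * (n + kappa).+1%:R by apply: mulr_gt0 => //; lra.
  by move=> h; lra.
rewrite addrC subrK lnM ?posrE//.
move: hn; rewrite ltr_pdivrMr// -addnS natrD.
have : e * n%:R = 2 * (d * n%:R) by rewrite /d; field.
by lra.
Unshelve. all: by end_near. Qed.

(** [x -> 1 - 1 / x] undoes [t -> 1 / (1 - t)], so this turns quantiles of the transformed zeros
    into limits of the zeros. *)
Lemma cot_limit_quantile (u : R) : 0 < u < 1 ->
  0 < limit_quantile u /\ 1 - (limit_quantile u)^-1 = - cot (pi * u / 2) ^+ 2.
Proof.
move=> /andP[u0 u1]; have p0 := pi_gt0 R.
have qE : limit_quantile u = sin (pi * u / 2) ^+ 2.
  rewrite /limit_quantile (_ : pi * (1 - u) / 2 = - (pi * u / 2 - pi / 2)).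
    by rewrite cosN cosBpihalf.
  by field.
have s0 : 0 < sin (pi * u / 2).
  by apply: sin_gt0_pihalf; apply/andP; split; nra.
rewrite qE; split; first by rewrite exprn_gt0.
rewrite /cot expr_div_n cos2sin2; field.
by rewrite gt_eqF.
Qed.

Variables (kappa : nat) (tau : nat -> nat -> R).
Hypothesis tau_zeros : forall r : nat, (2 <= r)%N ->
  increasing_negative_zeros
    (qzeta_numerator_at1 (@trapezoid_rank r (2 * r + kappa)) R) r.-1 (tau r).

Lemma tau_lt0 n j : (1 <= j <= n)%N -> tau n.+1 j < 0.
Proof.
move=> hj; have n2 : (2 <= n.+1)%N by case/andP: hj; lia.
by have [_ h _] := tau_zeros n2; exact: h.
Qed.

Lemma tau_lt n i j : (1 <= i)%N -> (i < j)%N -> (j <= n)%N ->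
  tau n.+1 i < tau n.+1 j.
Proof.
move=> i1 ij jn; have n2 : (2 <= n.+1)%N by lia.
by have [h _ _] := tau_zeros n2; exact: h.
Qed.

Lemma tau_root n j : (1 <= j <= n)%N -> root (segre_numerator R n kappa) (tau n.+1 j).
Proof.
move=> hj; have n2 : (2 <= n.+1)%N by case/andP: hj; lia.
have [_ neg zeros] := tau_zeros n2.
(* All zeros are negative, so 1 serves as the point that rules out the default numerator 0. *)
have r1 : ~~ root (qzeta_numerator_at1 (@trapezoid_rank n.+1 (2 * n.+1 + kappa)) R) 1.
  by apply/negP => /zeros[k hk e]; have := neg k hk; rewrite -e ltNge ler01.
have /zeros : exists2 k, (1 <= k <= n.+1.-1)%N & tau n.+1 j = tau n.+1 k by exists j.
rewrite (qzeta_numerator_at1_trapezoid _ _ r1)//; last by lia.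
by rewrite (_ : (2 * n.+1 + kappa - n.+1).-1 = n + kappa)%N//; lia.
Qed.

Let w n j := (1 - tau n.+1 j)^-1.

Let w01 n j : (1 <= j <= n)%N -> 0 <= w n j <= 1.
Proof.
move=> /tau_lt0 t0; rewrite /w invr_ge0 invf_le1; first by apply/andP; split; lra.
by lra.
Qed.

Let w_le n i j : (1 <= i)%N -> (i <= j)%N -> (j <= n)%N -> w n i <= w n j.
Proof.
move=> i1; rewrite leq_eqVlt => /predU1P[->//|ij] jn.
have h1 := tau_lt i1 ij jn; have h2 : tau n.+1 j < 0 by apply: tau_lt0; lia.
by rewrite /w lef_pV2 ?posrE; lra.
Qed.

Let ln_cvg z : 0 < z < 1 ->
  avg n (fun j => ln (1 + z * w n j) -
                  ln (1 + z * cos (even_angle R n j) ^+ 2)) @[n --> \oo] --> (0 : R).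
Proof.
move=> /andP[z0 _].
have h : 4 * kappa.+1%:R * (ln (n + kappa).+1%:R / n%:R) @[n --> \oo] --> (0 : R).
  by have := cvgMl_tmp (a := 4 * kappa.+1%:R) (cvg_ln_div kappa); rewrite mulr0; exact.
apply/cvgr0Pnorm_le => e e0; move/cvgr0Pnorm_le/(_ _ e0) : h => h.
near=> n; have n0 : (0 < n)%N by near: n; exact: nbhs_infty_gt.
have hn : `|4 * kappa.+1%:R * (ln (n + kappa).+1%:R / n%:R) : R| <= e by near: n.
apply: le_trans hn; apply: le_trans (ler_norm _).
rewrite /avg sumrB normrM ger0_norm ?invr_ge0// mulrC mulrA ler_wpM2r ?invr_ge0//.
apply: log_gap => //; first exact: ltW.
- move=> i j hi hj e'; apply/eqP; rewrite eqn_leq.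
  move: hi hj; rewrite !inE => /andP[i1 iN] /andP[j1 jn].
  have [ij|ji|_] := ltngtP i j; last by [].
  + by have := tau_lt i1 ij jn; rewrite e' ltxx.
  + by have := tau_lt j1 ji iN; rewrite e' ltxx.
- by move=> i hi; exact: tau_root.
- by move=> i hi; exact: tau_lt0.
Unshelve. all: by end_near. Qed.

Lemma tau_quantile_cvg (u : R) (j : nat -> nat) : 0 < u < 1 ->
  (forall n, (1 <= n)%N -> (1 <= j n <= n)%N) ->
  (j n)%:R / n%:R @[n --> \oo] --> u ->
  tau n.+1 (j n) @[n --> \oo] --> - cot (pi * u / 2) ^+ 2.
Proof.
move=> u01 hj ju; have [q0 <-] := cot_limit_quantile u01.
have h := quantile_cvg w01 w_le ln_cvg u01 hj ju.
have {}h : (w n (j n))^-1 @[n --> \oo] --> (limit_quantile u)^-1.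
  by apply: cvgV => //; rewrite gt_eqF.
have h1 : (fun=> 1 : R) @ \oo --> (1 : R) by exact: cvg_cst.
rewrite (_ : (fun n => tau n.+1 (j n)) = (fun=> 1) - (fun n => (w n (j n))^-1)).
  exact: cvgB.
by apply/funext => n; rewrite /w !fctE invrK; ring.
Qed.

End TrapezoidZeros.

(** * Weak convergence *)

Section RiemannSums.
Variable R : realType.
Local Notation mu := (@lebesgue_measure R).

Definition cell (n j : nat) : set R := `[j.-1%:R / n%:R, j%:R / n%:R[.

Definition step_fun (n : nat) (c : nat -> R) (u : R) : R :=
  \sum_(1 <= j < n.+1) c j * \1_(cell n j) u.

Lemma step_fun_cell n (c : nat -> R) j (u : R) : (1 <= j <= n)%N ->
  cell n j u -> step_fun n c u = c j.
Proof.
move=> hj uj; have n0 : 0 < n%:R :> R by rewrite ltr0n; lia.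
rewrite /step_fun (bigD1_seq j) ?iota_uniq ?mem_index_iota //=.
rewrite indicE mem_set// mulr1 big_nat_cond big1 ?addr0// => i /andP[/andP[i1 iN] ij].
rewrite indicE memNset ?mulr0// => ui; move: uj ui ij.
rewrite /cell /= !in_itv /= !ler_pdivrMr// !ltr_pdivlMr// => /andP[h1 h2] /andP[h3 h4].
have := le_lt_trans h1 h4; have := le_lt_trans h3 h2; rewrite !ltr_nat.
by move=> ? ?; lia.
Qed.

Lemma cellP n (u : R) : (0 < n)%N -> 0 <= u < 1 ->
  exists2 j, (1 <= j <= n)%N & cell n j u.
Proof.
move=> n0 /andP[u0 u1]; have n0' : 0 < n%:R :> R by rewrite ltr0n.
have nu : 0 <= n%:R * u by rewrite mulr_ge0// ltW.
have /andP[h1 h2] := truncn_itv nu.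
exists (Num.truncn (n%:R * u)).+1.
  apply/andP; split=> //; rewrite -(ltr_nat R) (le_lt_trans h1)//.
  by rewrite -[ltRHS]mulr1 ltr_pM2l.
by rewrite /cell /= in_itv /= ler_pdivrMr// ltr_pdivlMr// ![u * _]mulrC h1 h2.
Qed.

Lemma cell_left n j : (1 <= j <= n)%N ->
  j.-1%:R / n%:R = j%:R / n%:R - n%:R^-1 :> R.
Proof.
case: j => // j /andP[_ jn]; have n0 : 0 < n%:R :> R by rewrite ltr0n; lia.
by rewrite /= -natr1; field; rewrite gt_eqF.
Qed.

Lemma cell_dist n j (u : R) : (1 <= j <= n)%N -> cell n j u ->
  `|u - j%:R / n%:R| <= n%:R^-1.
Proof.
move=> hj; rewrite /cell /= in_itv /= (cell_left hj) => /andP[h1 h2].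
have : 0 <= n%:R^-1 :> R by [].
by rewrite ler_norml => h0; apply/andP; split; lra.
Qed.

Lemma measurable_cell n j : measurable (cell n j).
Proof. exact: measurable_itv. Qed.

Lemma measurable_step_fun n c D : measurable_fun D (step_fun n c).
Proof.
apply: measurable_funTS; rewrite /step_fun; apply: measurable_sum => j.
apply: measurable_realfun.measurable_funM; first exact: measurable_cst.
by apply: measurable_realfun.measurable_indic; exact: measurable_cell.
Qed.

Lemma measure_cell n j : (1 <= j <= n)%N -> mu (cell n j `&` `[0, 1[) = (n%:R^-1)%:E.
Proof.
move=> hj; have n0 : 0 < n%:R :> R by rewrite ltr0n; lia.
have e := cell_left hj.
rewrite setIidl; last first.
  move=> u; rewrite /cell /= !in_itv /= => /andP[h1 h2]; apply/andP; split.
    by rewrite (le_trans _ h1)// divr_ge0// ltW.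
  rewrite (lt_le_trans h2)// ler_pdivrMr// mul1r ler_nat; lia.
rewrite /cell lebesgue_measure_itv /= lte_fin e ltrBlDr ltrDl invr_gt0 n0.
by rewrite -EFinB opprB addrCA subrr addr0.
Qed.

Lemma integral_step_fun n (c : nat -> R) : (0 < n)%N ->
  (\int[mu]_(u in `[0%R, 1%R[) (step_fun n c u)%:E = (avg n c)%:E)%E.
Proof.
move=> n0; rewrite /step_fun.
under eq_integral do rewrite -sumEFin.
have ci j : mu.-integrable `[0%R, 1%R[ (EFin \o \1_(cell n j)).
  by apply: integrableS (@integrable_indic_itv R _ _ _ _).
rewrite integral_sum//; last first.
  by move=> j; apply: eq_integrable (integrableZl _ (c j) (ci j)).
rewrite /avg mulr_sumr -sumEFin; apply: eq_big_nat => j hj.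
under eq_integral do rewrite EFinM.
rewrite (integralZl _ (ci j)) //.
have := @integral_indic _ _ _ mu `[0, 1[ _ _ (measurable_cell n j) => /= ->//.
by rewrite measure_cell// -EFinM mulrC.
Qed.

Lemma cell_cvg (u : R) (j : nat -> nat) :
  (forall n, (0 < n)%N -> (1 <= j n <= n)%N /\ cell n (j n) u) ->
  (j n)%:R / n%:R @[n --> \oo] --> u.
Proof.
move=> hj; apply/cvgrPdist_le => e e0; near=> n.
have n0 : (0 < n)%N by near: n; exact: nbhs_infty_gt.
have [h1 h2] := hj n n0; rewrite (le_trans (cell_dist h1 h2))//.
rewrite invf_ple ?posrE ?ltr0n//.
by apply: ltW; near: n; exact: nbhs_infty_gtr.
Unshelve. all: by end_near. Qed.

(** The average is the integral of a step function. At a fixed [u] its value is [a n (j n)] for the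
    cell containing [u], where [j n / n] tends to [u]; the bound [M] then permits dominated
    convergence. *)
Lemma avg_cvg_integral (a : nat -> nat -> R) (G : R -> R) (M : R) :
  (forall n j, (1 <= j <= n)%N -> `|a n j| <= M) ->
  {in `]0, 1[, continuous G} ->
  (forall (u : R) (j : nat -> nat), 0 < u < 1 ->
    (forall n, (1 <= n)%N -> (1 <= j n <= n)%N) ->
    (j n)%:R / n%:R @[n --> \oo] --> u ->
    a n (j n) @[n --> \oo] --> G u) ->
  avg n (a n) @[n --> \oo] --> \int[mu]_(u in `]0, 1[) G u.
Proof.
move=> aM cG aG.
have mG : measurable_fun (`]0, 1[ : set R) G.
  apply: measurable_realfun.open_continuous_measurable_fun.
    exact: interval_open.
  by move=> u; rewrite inE; exact: cG.
have iM : mu.-integrable `]0%R, 1%R[ (EFin \o cst M).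
  apply: measurable_bounded_integrable => //.
  - apply: (@le_lt_trans _ _ 1%E); last exact: ltry.
    by have := @lebesgue_measure_itv R `]0, 1[; rewrite /= lte_fin ltr01 oppr0 adde0 => <-.
  - exact: bounded_cst.
have M0 : 0 <= M by apply: le_trans (aM 1%N 1%N isT).
have step_at n (u : R) : (0 < n)%N -> 0 < u < 1 ->
    exists2 j, (1 <= j <= n)%N & cell n j u /\ step_fun n (a n) u = a n j.
  move=> n0 /andP[u0 u1]; have [|j hj uj] := @cellP n u n0; first by rewrite ltW.
  by exists j => //; split=> //; exact: step_fun_cell.
have step_cvg (u : R) : 0 < u < 1 ->
    step_fun n (a n) u @[n --> \oo] --> G u.
  move=> u01.
  (* For [n = 0] there are no cells and the index is arbitrary. *)
  have /choice[j hj] : forall n, exists j, (0 < n)%N ->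
      [/\ (1 <= j <= n)%N, cell n j u & step_fun n (a n) u = a n j].
    move=> n; have [->|n0] := posnP n; first by exists 0%N.
    by have [j ? [? ?]] := step_at n u n0 u01; exists j.
  have : a n (j n) @[n --> \oo] --> G u.
    apply: aG => //; first by move=> n /hj[].
    by apply: cell_cvg => n /hj[].
  apply: cvg_trans; apply: near_eq_cvg; near=> n.
  have n0 : (0 < n)%N by near: n; exact: nbhs_infty_gt.
  by have [_ _ ->] := hj n n0.
have [] := @dominated_convergence _ _ _ mu `]0, 1[ (measurable_itv _)
  (fun n => EFin \o step_fun n (a n)) (EFin \o G) (EFin \o cst M).
- by move=> n; apply/measurable_realfun.measurable_EFinP; exact: measurable_step_fun.
- exact/measurable_realfun.measurable_EFinP.
- apply: aeW => u /=; rewrite in_itv /= => u01.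
  by apply: cvg_EFin; [exact: nearW | exact: step_cvg].
- exact: iM.
- apply: aeW => u n /=; rewrite in_itv /= => u01; rewrite lee_fin.
  have [->|n0] := posnP n; first by rewrite /step_fun big_geq// normr0.
  by have [j hj [_ ->]] := step_at n u n0 u01; exact: aM.
move=> iG _; rewrite -[X in _ --> X]fineK; last exact: integrable_fin_num.
move=> /fine_cvg h; apply: cvg_trans h; apply: near_eq_cvg; near=> n.
have n0 : (0 < n)%N by near: n; exact: nbhs_infty_gt.
(* The cells tile [[0, 1)], while the limit is controlled only on [(0, 1)]; the endpoint 0 has
   measure zero. *)
rewrite /= integral_itv_obnd_cbnd; last first.
  by apply/measurable_realfun.measurable_EFinP; exact: measurable_step_fun.
by rewrite integral_step_fun.
Unshelve. all: by end_near. Qed.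

End RiemannSums.

(** * The limit law on the negative half-line *)

Section ChangeOfVariables.
Variable R : realType.
Local Notation mu := (@lebesgue_measure R).

(* The limiting distribution function, inverse to
   [u |-> 1 - (limit_quantile u)^-1]. *)
Definition limit_cdf (t : R) : R := 1 - 2 / pi * atan (Num.sqrt (- t)).

Definition limit_density (t : R) : R := pi^-1 * (Num.sqrt (- t) * (1 - t))^-1.

Lemma continuous_limit_cdf : continuous limit_cdf.
Proof.
move=> t; apply: cvgB; first exact: cvg_cst.
apply: cvgM; first exact: cvg_cst.
apply: (@continuous_comp _ _ _ (fun t : R => Num.sqrt (- t)) atan); last exact: continuous_atan.
apply: (@continuous_comp _ _ _ -%R Num.sqrt); last exact: sqrt_continuous.
exact: opp_continuous.
Qed.

Lemma is_derive_limit_cdf (t : R) : t < 0 ->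
  is_derive t 1 limit_cdf (limit_density t).
Proof.
move=> t0; have nt0 : 0 < - t by rewrite oppr_gt0.
have s0 : 0 < Num.sqrt (- t) by rewrite sqrtr_gt0.
have s2 : Num.sqrt (- t) ^+ 2 = - t by rewrite sqr_sqrtr// ltW.
have d1 := is_derive1_comp (is_derive1_sqrt nt0) (is_deriveNid t 1).
have d2 := @is_derive1_comp _ atan (Num.sqrt \o -%R) t _ _
  (is_derive1_atan (Num.sqrt (- t))) d1.
have d3 := is_deriveB (is_derive_cst (1 : R) t 1) (is_deriveZ (2 / pi) d2).
apply: (@is_derive_eq _ _ _ _ _ _ _ _ d3).
have h1 : 0 < 1 - t by lra.
rewrite /limit_density s2 -[_ *: _]/(_ * _); move: (pi_gt0 R); move: pi => p p0.
by field; rewrite !gt_eqF.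
Qed.

Lemma limit_cdf_lt (s t : R) : s < t -> t <= 0 -> limit_cdf s < limit_cdf t.
Proof.
move=> st t0; rewrite /limit_cdf ltrD2l ltrN2 ltr_pM2l ?divr_gt0 ?pi_gt0//.
by apply: lt_atan; rewrite ltr_sqrt ?ltrN2// oppr_gt0 (lt_le_trans st).
Qed.

Lemma limit_cdf_itv (t : R) : t < 0 -> 0 < limit_cdf t < 1.
Proof.
move=> t0; have p0 := pi_gt0 R; rewrite /limit_cdf.
have h1 := atan_ltpi2 (Num.sqrt (- t)).
have h2 : 0 < atan (Num.sqrt (- t)).
  by rewrite -[ltLHS](@atan0 R); apply: lt_atan; rewrite sqrtr_gt0 oppr_gt0.
have h3 : 0 < 2 / pi * atan (Num.sqrt (- t)) by rewrite mulr_gt0// divr_gt0.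
have h4 : 2 / pi * atan (Num.sqrt (- t)) < 1.
  by rewrite mulrAC ltr_pdivrMr//; lra.
by apply/andP; split; lra.
Qed.

Lemma limit_quantile_cdf (t : R) : t < 0 ->
  limit_quantile (limit_cdf t) = (1 - t)^-1.
Proof.
move=> t0; have p0 := pi_gt0 R; rewrite /limit_quantile /limit_cdf.
rewrite (_ : pi * _ / 2 = atan (Num.sqrt (- t))); last first.
  by move: p0; move: pi => p p0; field; rewrite gt_eqF.
rewrite cos_atan exprVn sqr_sqrtr ?addr_ge0 ?sqr_ge0// sqr_sqrtr//.
by rewrite oppr_ge0 ltW.
Qed.

Lemma continuous_limit_density (t : R) : t < 0 -> {for t, continuous limit_density}.
Proof.
move=> t0; apply: cvgM; first exact: cvg_cst.
apply: cvgV.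
  by rewrite mulf_neq0// gt_eqF// ?sqrtr_gt0; lra.
apply: cvgM.
  apply: (@continuous_comp _ _ _ -%R Num.sqrt); last exact: sqrt_continuous.
  exact: opp_continuous.
by apply: cvgB; [exact: cvg_cst|exact: cvg_id].
Qed.

Lemma Rintegral_support (D E : set R) (f : R -> R) : E `<=` D ->
  (forall x, D x -> ~ E x -> f x = 0) ->
  \int[mu]_(x in D) f x = \int[mu]_(x in E) f x.
Proof.
move=> ED f0; rewrite Rintegral_mkcond [RHS]Rintegral_mkcond.
congr Rintegral; apply/funext => x; rewrite !patchE.
case: ifPn => [/set_mem Dx|/negP Dx]; case: ifPn => [/set_mem Ex|/negP Ex] //.
  by apply: f0 => // Ex'; apply: Ex; exact: mem_set.
by case: Dx; apply: mem_set; exact: ED.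
Qed.

Lemma derive1_limit_cdf (t : R) : t < 0 -> derive1 limit_cdf t = limit_density t.
Proof.
by move=> /is_derive_limit_cdf h; rewrite derive1E (@derive_val _ _ _ _ _ _ _ h).
Qed.

Lemma cvg_derive1_limit_cdf (t : R) : t < 0 ->
  derive1 limit_cdf x @[x --> t] --> limit_density t.
Proof.
move=> t0; apply: cvg_trans (continuous_limit_density t0).
apply: near_eq_cvg; near=> x; apply/esym/derive1_limit_cdf.
by near: x; exact: lt_nbhsl.
Unshelve. all: by end_near. Qed.

(** Substitution of [u = limit_cdf t]. The support in [[A, B]] with [B < 0] confines it to a compact
    interval, away from the singularity of the density at 0 and from infinity. *)
Lemma change_of_variables (F : R -> R) (A B : R) : continuous F ->
  A < B -> B < 0 -> (forall t, t < A \/ B < t -> F t = 0) ->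
  \int[mu]_(u in `]0, 1[) F (1 - (limit_quantile u)^-1) =
  pi^-1 * \int[mu]_(t in `]-oo, 0[) (F t / (Num.sqrt (- t) * (1 - t))).
Proof.
move=> cF AB B0 F0; have A0 := lt_trans AB B0.
have /andP[A1 A2] := limit_cdf_itv A0; have /andP[B1 B2] := limit_cdf_itv B0.
pose G u := F (1 - (limit_quantile u)^-1).
have q0 (u : R) : 0 < u < 1 -> 0 < limit_quantile u by move=> /cot_limit_quantile[].
have cG (u : R) : 0 < u < 1 -> {for u, continuous G}.
  move=> u01; apply: (@continuous_comp _ _ _ (fun u : R => 1 - (limit_quantile u)^-1) F).
    apply: cvgB; first exact: cvg_cst.
    by apply: cvgV; [rewrite gt_eqF ?q0 | exact: continuous_limit_quantile].
  exact: cF.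
transitivity (\int[mu]_(u in `[limit_cdf A, limit_cdf B]) G u).
  apply: Rintegral_support => u /=; rewrite !in_itv /=.
    by move=> /andP[h1 h2]; rewrite (lt_le_trans A1)// (le_lt_trans h2).
  move=> /andP[u0 u1] /negP; rewrite negb_and -!ltNge => /orP[uA|uB]; apply: F0.
    left; have := limit_quantile_lt (ltW u0) uA (ltW A2).
    have := q0 u; rewrite u0 u1 => /(_ isT) q.
    rewrite limit_quantile_cdf// -ltf_pV2 ?posrE ?invr_gt0 ?invrK//; lra.
  right; have := limit_quantile_lt (ltW B1) uB (ltW u1).
  have := q0 u; rewrite u0 u1 => /(_ isT) q.
  rewrite limit_quantile_cdf// -ltf_pV2 ?posrE ?invr_gt0 ?invrK//; lra.
transitivity (\int[mu]_(t in `[A, B]) (pi^-1 * (F t / (Num.sqrt (- t) * (1 - t))))).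
  rewrite /Rintegral integration_by_substitution_increasing; last first.
  - apply: continuous_in_subspaceT => u /set_mem /=; rewrite in_itv /= => /andP[h1 h2].
    by apply: cG; rewrite (lt_le_trans A1)// (le_lt_trans h2).
  - split.
    + move=> t; rewrite in_itv /= => /andP[_ tB].
      by have [] := is_derive_limit_cdf (lt_trans tB B0).
    + by apply: cvg_at_right_filter; exact: continuous_limit_cdf.
    + by apply: cvg_at_left_filter; exact: continuous_limit_cdf.
  - apply/cvg_ex; exists (limit_density B); apply: cvg_at_left_filter.
    exact: cvg_derive1_limit_cdf.
  - apply/cvg_ex; exists (limit_density A); apply: cvg_at_right_filter.
    exact: cvg_derive1_limit_cdf.
  - move=> t; rewrite in_itv /= => /andP[_ tB]; have t0 := lt_trans tB B0.
    by rewrite /continuous_at derive1_limit_cdf//; exact: cvg_derive1_limit_cdf.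
  - move=> s t; rewrite !in_itv /= => _ /andP[_ tB] st.
    by apply: limit_cdf_lt => //; rewrite (le_trans tB)// ltW.
  - exact: ltW.
  congr fine; apply: eq_integral => t; rewrite inE /= in_itv /= => /andP[At tB].
  have t0 := le_lt_trans tB B0.
  congr EFin; rewrite !fctE /= derive1_limit_cdf// /G limit_quantile_cdf// invrK.
  by rewrite /limit_density opprB addrCA subrr addr0 mulrCA.
rewrite RintegralZl//; last first.
  apply: continuous_compact_integrable; first exact: segment_compact.
  apply: continuous_in_subspaceT => t /set_mem /=; rewrite in_itv /= => /andP[_ tB].
  have t0 := le_lt_trans tB B0.
  rewrite (_ : (fun t => _) = (F \* (pi \*o limit_density))).
    apply: continuousM; first exact: cF.
    apply: continuousM; first exact: cst_continuous.
    exact: continuous_limit_density.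
  apply/funext => x /=; rewrite /limit_density mulVKf//.
  by rewrite gt_eqF// pi_gt0.
congr (_ * _); apply/esym/Rintegral_support => t /=; rewrite !in_itv /=.
  by move=> /andP[_ tB]; rewrite (le_lt_trans tB).
by move=> _ /negP; rewrite negb_and -!ltNge => /orP h; rewrite F0 ?mul0r//.
Qed.

End ChangeOfVariables.

(** * Test functions supported in the open half-line *)

Section TestFunctions.
Variables (R : realType) (f : R -> R).
Hypothesis fU : continuous_compactly_supported_on `]-oo, 0[ f.

(** The values of [f] on [[0, +oo)] are arbitrary; replacing them by 0 gives a function continuous
    on the whole line with the same integral and the same averages over the zeros. *)
Definition extend0 (t : R) : R := if t < 0 then f t else 0.

(** If the compact support is nonempty it attains its maximum [b], and [b] belongs to the open
    half-line: this separates the support from 0. *)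
Lemma extend0_support : exists A B : R, [/\ A < B, B < 0 &
  forall t, t < A \/ B < t -> extend0 t = 0].
Proof.
have [_ cK] := fU; set K := (X in compact X) in cK.
have KP t : extend0 t != 0 -> K t.
  rewrite /extend0; case: ifPn => [t0 ft|_]; last by rewrite eqxx.
  split; first by rewrite /= in_itv.
  by apply: subset_closure; split; rewrite //= in_itv.
have [K0|/set0P K0] := eqVneq K set0.
  exists (-2), (-1); split; [lra|lra|move=> t _].
  by apply/eqP/negPn/negP => /KP; rewrite K0.
have [M [_ KM]] := compact_bounded cK.
have [b /set_mem Kb bmax] : exists2 b, b \in K & forall t, t \in K -> t <= b.
  by apply: compact_EVT_max => //; apply: continuous_in_subspaceT => t _; exact: cvg_id.
have b0 : b < 0 by case: Kb; rewrite /= in_itv.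
(* [- (M + 1)] bounds the support from below, and [b - 1] secures [A < B]. *)
exists (Num.min (b - 1) (- (M + 1))), b; split => //.
  by rewrite gt_min; apply/orP; left; lra.
move=> t h; apply/eqP/negPn/negP => /KP Kt.
have := bmax t (mem_set Kt); have := KM (M + 1) _ t Kt; rewrite ltrDl ltr01 => /(_ isT).
rewrite /= ler_norml => /andP[h1 h2] h3; case: h => [|h4]; last lra.
by rewrite lt_min => /andP[_]; lra.
Qed.

Lemma continuous_extend0 : continuous extend0.
Proof.
have [A [B [AB B0 F0]]] := extend0_support.
have [cf _] := fU; move=> t; have [t0|t0] := ltP t 0; last first.
  have e0 : extend0 t = 0 by apply: F0; right; exact: lt_le_trans t0.
  rewrite /continuous_at e0.
  apply: cvg_near_cst; near=> x; apply: F0; right.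
  by near: x; apply: lt_nbhsr; exact: lt_le_trans t0.
have ft : {for t, continuous f}.
  move: cf; rewrite continuous_open_subspace; last exact: interval_open.
  by apply; rewrite inE /= in_itv.
rewrite /continuous_at {2}/extend0 t0; apply: cvg_trans ft.
apply: near_eq_cvg; near=> x; rewrite /extend0 ifT//.
by near: x; exact: lt_nbhsl.
Unshelve. all: by end_near. Qed.

Lemma extend0_bounded : exists M : R, forall t, `|extend0 t| <= M.
Proof.
have [A [B [AB B0 F0]]] := extend0_support.
have cF : {within `[A, B], continuous (fun t => `|extend0 t|)}.
  apply: continuous_in_subspaceT => t _; apply: continuous_comp; first exact: continuous_extend0.
  exact: norm_continuous.
have [c _ cmax] := EVT_max (ltW AB) cF.
exists (`|extend0 c|) => t; have [h|h] := boolP (t \in `[A, B]); first exact: cmax.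
rewrite F0 ?normr0//; move: h; rewrite in_itv /= negb_and -!ltNge.
by case/orP => ?; [left|right].
Qed.

End TestFunctions.

Section MainTheorem.
Variables (R : realType) (kappa : nat) (tau : nat -> nat -> R).
Hypothesis tau_zeros : forall r : nat, (2 <= r)%N ->
  increasing_negative_zeros
    (qzeta_numerator_at1 (@trapezoid_rank r (2 * r + kappa)) R) r.-1 (tau r).

Lemma tau_equidistributed (f : R -> R) :
  continuous_compactly_supported_on `]-oo, 0[ f ->
  avg n (fun j => f (tau n.+1 j)) @[n --> \oo] -->
    pi^-1 * \int[lebesgue_measure]_(t in `]-oo, 0[)
      (f t / (Num.sqrt (- t) * (1 - t))).
Proof.
move=> fU; have [A [B [AB B0 F0]]] := extend0_support fU.
have cF := continuous_extend0 fU; have [M FM] := extend0_bounded fU.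
have -> : \int[lebesgue_measure]_(t in `]-oo, 0[) (f t / (Num.sqrt (- t) * (1 - t))) =
    \int[lebesgue_measure]_(t in `]-oo, 0[) (extend0 f t / (Num.sqrt (- t) * (1 - t))).
  by apply: eq_Rintegral => t; rewrite inE /= in_itv /= => t0; rewrite /extend0 t0.
rewrite -(change_of_variables cF AB B0 F0).
have -> : (fun n => avg n (fun j => f (tau n.+1 j))) =
    (fun n => avg n (fun j => extend0 f (tau n.+1 j))).
  apply/funext => n; rewrite /avg; congr (_ * _); apply: eq_big_nat => j hj.
  by rewrite /extend0 (tau_lt0 tau_zeros).
apply: (avg_cvg_integral (M := M)) => //.
  move=> u; rewrite in_itv /= => u01.
  apply: (@continuous_comp _ _ _ (fun u : R => 1 - (limit_quantile u)^-1)); last exact: cF.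
  apply: cvgB; first exact: cvg_cst.
  have [q0 _] := cot_limit_quantile u01.
  by apply: cvgV; [rewrite gt_eqF | exact: continuous_limit_quantile].
move=> u j u01 hj ju; have [_ ->] := cot_limit_quantile u01.
apply: continuous_cvg; first exact: cF.
exact: (tau_quantile_cvg tau_zeros).
Qed.

End MainTheorem.

Unset Implicit Arguments.
Set Strict Implicit.
Set Printing Implicit Defensive.

Theorem corollary4p12 (R : realType) (kappa : nat) (tau : nat -> nat -> R)
  (tau_zeros : forall r : nat, (2 <= r)%N ->
    increasing_negative_zeros
      (qzeta_numerator_at1 (@trapezoid_rank r (2 * r + kappa)) R)
      r.-1 (tau r)) :
  (forall f : R -> R,
     continuous_compactly_supported_on `]-oo, 0[ f ->
     (r.-1%:R)^-1 * (\sum_(1 <= j < r) f (tau r j)) @[r --> \oo] -->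
       pi^-1 * (\int[lebesgue_measure]_(t in `]-oo, 0%R[)
                  (f t / (Num.sqrt (- t) * (1 - t)))))
  /\
  (forall (u : R) (j : nat -> nat), 0 < u < 1 ->
     (forall r : nat, (2 <= r)%N -> (1 <= j r <= r.-1)%N) ->
     (j r)%:R / (r.-1)%:R @[r --> \oo] --> u ->
     tau r (j r) @[r --> \oo] --> - (cot (pi * u / 2)) ^+ 2).
Proof.
(* With [r = n + 1] the normalised sum over [1 <= j < r] is [avg n]. *)
split=> [f fU | u j u01 hj ju]; rewrite -cvg_shiftS.
  exact: (tau_equidistributed tau_zeros).
apply: (tau_quantile_cvg tau_zeros u01 (j := fun n => j n.+1)).
  by move=> n n0; exact: hj.
by move: ju; rewrite -cvg_shiftS.
Qed.
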